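(* With the notation of the context, $$\partial\Omega_+=\partial\Omega_-=W^s(0)\cup W^s(p,p')=J^+_{\mathbb{R}},$$ where $\partial$ denotes the boundary in $\mathbb{R}^2$.
   Context: Let $f(z,w)=(w,\tfrac{z}{2}-w^3+\tfrac34 w)$, a polynomial automorphism of $\mathbb{C}^2$ which restricts to a bijection $f:\mathbb{R}^2\to\mathbb{R}^2$, $f(x,y)=(y,\tfrac{x}{2}-y^3+\tfrac34 y)$. Its real fixed points include $0=(0,0)$, a saddle, and $p_+=(\tfrac12,\tfrac12)$, $p_-=(-\tfrac12,-\tfrac12)$, which are attracting. The points $p=(-\tfrac{\sqrt5}{2},\tfrac{\sqrt5}{2})$ and $p'=(\tfrac{\sqrt5}{2},-\tfrac{\sqrt5}{2})$ form a saddle cycle of period two. The real basins are $\Omega_+=\{q\in\mathbb{R}^2: f^n(q)\to p_+ \text{ as } n\to\infty\}$ and $\Omega_-=\{q\in\mathbb{R}^2: f^n(q)\to p_-\text{ as } n\to\infty\}$. The real stable manifolds are $W^s(0)=\{q\in\mathbb{R}^2: f^n(q)\to 0 \text{ as } n\to\infty\}$ and $W^s(p,p')=\{q\in\mathbb{R}^2: d(f^n(q),\{p,p'\})\to 0\text{ as } n\to\infty\}$, where $d$ is Euclidean distance. Let $K^+\subset\mathbb{C}^2$ be the set of points with bounded forward orbit under $f$, let $J^+=\partial K^+$ (boundary in $\mathbb{C}^2$), and $J^+_{\mathbb{R}}=J^+\cap\mathbb{R}^2$. *)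

(* Defs.v *)
From HB Require Import structures.
From mathcomp Require Import all_boot all_order all_algebra.
From mathcomp Require Import all_classical all_reals all_analysis.
From mathcomp Require Import complex.

Set Implicit Arguments.
Unset Strict Implicit.
Unset Printing Implicit Defensive.

Import Order.TTheory GRing.Theory Num.Theory.
Import numFieldNormedType.Exports.

Local Open Scope classical_set_scope.
Local Open Scope ring_scope.
Local Open Scope complex_scope.

Definition boundary (T : topologicalType) (A : set T) : set T :=
  closure A `\` interior A.

Definition henon (K : fieldType) (q : K * K) : K * K :=
  (q.2, q.1 / 2 - q.2 ^+ 3 + 3 / 4 * q.2).

Section RealDynamics.
Variable R : realType.

Definition forward_orbit (q : R * R) (n : nat) : R * R := iter n (@henon R) q.

Definition fixed_zero : R * R := (0, 0).
Definition fixed_plus : R * R := (1 / 2, 1 / 2).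
Definition fixed_minus : R * R := (- (1 / 2), - (1 / 2)).
Definition saddle_p : R * R := (- (Num.sqrt 5 / 2), Num.sqrt 5 / 2).
Definition saddle_p' : R * R := (Num.sqrt 5 / 2, - (Num.sqrt 5 / 2)).

Definition Omega_plus : set (R * R) :=
  [set q | forward_orbit q n @[n --> \oo] --> fixed_plus].
Definition Omega_minus : set (R * R) :=
  [set q | forward_orbit q n @[n --> \oo] --> fixed_minus].

Definition Ws_zero : set (R * R) :=
  [set q | forward_orbit q n @[n --> \oo] --> fixed_zero].

(* The norm of the library on R * R is the sup norm, hence an explicit
   Euclidean distance. *)
Definition euclidean_dist (q s : R * R) : R :=
  Num.sqrt ((q.1 - s.1) ^+ 2 + (q.2 - s.2) ^+ 2).

Definition dist_to_set (q : R * R) (A : set (R * R)) : R :=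
  inf [set euclidean_dist q s | s in A].

Definition Ws_cycle : set (R * R) :=
  [set q | dist_to_set (forward_orbit q n) [set saddle_p; saddle_p']
             @[n --> \oo] --> (0 : R)].

End RealDynamics.

Section ComplexDynamics.
Variable R : realType.

(* R[i] itself carries no topology in the library; R[i]^o is the same field
   with the topology given by the modulus. *)
Definition C2 : normedModType R[i] := (R[i]^o * R[i]^o)%type.

Definition K_plus : set C2 :=
  [set q | bounded_set (range (fun n => iter n (@henon R[i]) q : C2))].

Definition J_plus : set C2 := boundary K_plus.

Definition real_to_C2 (q : R * R) : C2 := (q.1%:C, q.2%:C).

(* J^+ intersected with R^2, as a subset of R^2. *)
Definition J_plus_real : set (R * R) := real_to_C2 @^-1` J_plus.

End ComplexDynamics.

Arguments Omega_plus : clear implicits.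
Arguments Omega_minus : clear implicits.
Arguments Ws_zero : clear implicits.
Arguments Ws_cycle : clear implicits.
Arguments K_plus : clear implicits.
Arguments J_plus : clear implicits.
Arguments J_plus_real : clear implicits.

(* Main.v *)
Require Import Defs.
From mathcomp Require Import all_boot all_order all_algebra.
From mathcomp Require Import cyclic separable cyclotomic.
From mathcomp Require Import all_classical all_reals all_analysis.
From mathcomp Require Import complex.
From mathcomp Require Import ring lra zify.

Set Implicit Arguments.
Unset Strict Implicit.
Unset Printing Implicit Defensive.

Import Order.TTheory GRing.Theory Num.Theory.
Import numFieldNormedType.Exports.

Local Open Scope classical_set_scope.
Local Open Scope ring_scope.

(**
An orbit of the map is a sequence [x] with
[x n.+2 = x n / 2 + g (x n.+1)], where [g t = 3/4 t - t^3], so everything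
real can be read off one scalar recurrence.  Write [a] for half the square
root of 5.

Every bounded real orbit tends to one of the two sinks, to the origin, or to
the saddle cycle ([bounded_orbit_limits]).  Let [M] be the upper limit of
[|x n|].  When [x n.+2] is close to [M], the value [g (x n.+1)] is at least
about [M / 2]; comparing with the shape of the cubic gives [M <= 1/2] or
[M >= a], and in the second case [x n.+1 <= - a], so that the next
step would exceed [M] unless [M = a].  If [M = a], closeness of [|x n|] to [a]
is inherited backwards in time, so the orbit converges to the cycle.  If
[M <= 1/2], the map is monotone on the square that attracts the orbit: either
two successive terms get the same sign and the orbit converges to a sink, or
the signs alternate and the even and odd terms shrink by a factor 2.

Every point of the two stable sets is a limit of points of each basin.  At the
origin, a diagonal perturbation grows until both coordinates lie in the
positive box, which is in a basin
([perturbed_stable_orbit_tends_to_half]).  Near the cycle, the sequence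
[(-1)^n x n] is governed by an expanding monotone recurrence.  By the
intermediate value theorem an arbitrarily small perturbation leaves the
neighbourhood of [a] through the level 103/100 at any prescribed large time
([exit_parameter_small]); a computation with intervals over the next steps
shows that two successive terms of [x] then get the same sign, which is fixed
by the parity of the exit time ([exit_enters_box]).  So the two
parities land in the two basins.  Together with the classification and the
openness of the basins this gives both real boundaries.

For the complex boundary, a real point of [K_plus] in a basin is interior
because an attracting bidisk is invariant ([trap_in_K_plus]).  A point of a
stable set is not interior: the derivatives of the iterates along its orbit
are unbounded, by expansion at the saddles
([tangent_unbounded_near_zero], [tangent_unbounded_near_cycle]), whereas on a
bidisk inside [K_plus] the iterates are uniformly bounded polynomials, whose
derivatives are bounded by the Cauchy estimate [cauchy_coef1].
*)

(** * Limits of real sequences and the attracting fixed point *)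

Section RealSequences.
Variable R : realType.
Implicit Types (x u z : nat -> R) (c e t : R).

Definition tends_to x l :=
  forall e, 0 < e -> exists N, forall n, (N <= n)%N -> `|x n - l| <= e.

(** These two epsilon properties are all that is used of the upper limit of
[|x n|]. *)
Lemma exists_abs_limsup x B : (forall n, `|x n| <= B) ->
  exists M, [/\ 0 <= M,
    (forall e, 0 < e -> exists N, forall n, (N <= n)%N -> `|x n| <= M + e) &
    (forall e N, 0 < e -> exists2 n, (N <= n)%N & M - e < `|x n|)].
Proof.
move=> xB; pose E := [set c | exists N, forall n, (N <= n)%N -> `|x n| <= c].
have E0 : lbound E 0.
  by move=> c [N Nc]; apply: le_trans (Nc N (leqnn N)); exact: normr_ge0.
have EB : E B by exists 0%N.
have infE : has_inf E by split; [exists B | exists 0].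
exists (inf E); split.
- by apply: lb_le_inf => //; exists B.
- move=> e e0; have [c [N Nc] cE] := inf_adherent e0 infE.
  by exists N => n Nn; apply: le_trans (Nc n Nn) (ltW cE).
- move=> e N e0; apply: contrapT => noN.
  have : E (inf E - e).
    exists N => n Nn; rewrite leNgt; apply/negP => xn.
    by apply: noN; exists n.
  move=> /(ge_inf infE.2); lra.
Qed.

(** The upper limit [M] of [|u n|] satisfies [M <= (1/2 + t) M], and the factor
is below 1. *)
Lemma contraction_tends_to0 u B t N : (forall n, `|u n| <= B) -> 0 <= t -> t < 1/2 ->
  (forall n, (N <= n)%N -> `|u n.+2| <= `|u n| / 2 + t * `|u n.+1|) ->
  tends_to u 0.
Proof.
move=> uB t0 t12 hu; have [M [M0 ub lb]] := exists_abs_limsup uB.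
suff M00 : M <= 0.
  move=> e e0; have [N' hN'] := ub _ e0; exists N' => n /hN'.
  rewrite subr0; lra.
rewrite leNgt; apply/negP => Mpos.
(* a quarter of the gap between [M] and the contracted value [(1/2 + t) M] *)
pose e := (1/2 - t) * M / 4.
have e0 : 0 < e by rewrite /e; apply: divr_gt0 => //; apply: mulr_gt0 => //; lra.
have [N' hN'] := ub _ e0.
have [n nN hn] := lb e (maxn N N').+2 e0.
have [m mE] : exists m, n = m.+2 by exists n.-2; lia.
rewrite mE in hn.
have h0 : `|u m| <= M + e by apply: hN'; lia.
have h1 : `|u m.+1| <= M + e by apply: hN'; lia.
have := hu m ltac:(lia).
have : t * `|u m.+1| <= t * (M + e) by apply: ler_wpM2l.
have : t * e <= 1/2 * e by apply: ler_wpM2r; lra.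
rewrite mulrDr.
have eE : 4 * e = M / 2 - t * M by rewrite /e; field.
lra.
Qed.

Definition henon_seq x :=
  forall n, x n.+2 = x n / 2 - x n.+1 ^+ 3 + 3 / 4 * x n.+1.

Lemma henon_seqN x : henon_seq x -> henon_seq (fun n => - x n).
Proof. by move=> hx n; rewrite hx; ring. Qed.

Lemma henon_seq_shift x N : henon_seq x -> henon_seq (fun n => x (n + N)%N).
Proof. by move=> hx n; exact: hx. Qed.

Lemma tends_to_shift x l N : tends_to (fun n => x (n + N)%N) l -> tends_to x l.
Proof.
move=> h e /h[N' hN']; exists (N' + N)%N => n hn.
by rewrite -[n](@subnK N) ?hN' //; lia.
Qed.

Lemma tends_toN x l : tends_to (fun n => - x n) (- l) -> tends_to x l.
Proof.
by move=> h e /h[N hN]; exists N => n /hN; rewrite -opprD normrN.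
Qed.


(** The cubic has a critical point at [1/2], so the deviation of [v] enters only
through [s^2 (3/2 + s)] with [s = v - 1/2]; on [- b <= s <= 2/25] this is at
most [b (3/2 - b) |s|], and [b (3/2 - b) < 1/2] as soon as [b < 1/2]. *)
Lemma near_half_contracts (u v b : R) : 1/10 <= b -> b <= 1/2 ->
  1/2 - b <= v -> v <= 29/50 ->
  `|u / 2 - v ^+ 3 + 3/4 * v - 1/2|
    <= `|u - 1/2| / 2 + b * (3/2 - b) * `|v - 1/2|.
Proof.
move=> b1 b2 v1 v2.
pose s := v - 1/2.
have -> : u / 2 - v ^+ 3 + 3/4 * v - 1/2
  = (u - 1/2) / 2 - s * (3/2 + s) * s by rewrite /s; field.
apply: le_trans (ler_normB _ _) _; rewrite -/s [`|_ / 2|]normrM.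
have -> : `|2^-1| = 2^-1 :> R by rewrite ger0_norm // invr_ge0 ler0n.
rewrite lerD2l !normrM ler_wpM2r //.
have [s0|s0] := leP 0 s.
- rewrite ?ger0_norm; [|lra..].
  have s8 : s <= 2/25 by rewrite /s; lra.
  have : s * s <= 2/25 * (2/25) by apply: ler_pM.
  have : 0 <= (b - 1/10) * (14/10 - b) by apply: mulr_ge0; lra.
  lra.
- have sb : - s <= b by rewrite /s; lra.
  rewrite ltr0_norm // ger0_norm; last lra.
  have : 0 <= (b + s) * (3/2 - b + s) by apply: mulr_ge0; lra.
  lra.
Qed.

(** Positive terms stay above a positive constant [c], because [g t >= c / 2]
whenever [c <= t <= 29/50]; then [near_half_contracts] with [b = 1/2 - c]
makes [x n - 1/2] a contracting sequence. *)
Lemma positive_tends_to_half x N : henon_seq x ->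
  (forall n, (N <= n)%N -> x n <= 29/50) -> 0 < x N -> 0 < x N.+1 ->
  tends_to x (1/2).
Proof.
move=> hx xub x0 x1; apply: (@tends_to_shift _ _ N).
pose y n := x (n + N)%N; rewrite -/y.
have hy : henon_seq y by exact: henon_seq_shift.
have yub n : y n <= 29/50 by apply: xub; lia.
have [c [c0 c4 cy0 cy1]] : exists c, [/\ 0 < c, c <= 2/5, c <= y 0%N & c <= y 1%N].
  exists (Num.min (2/5) (Num.min (x N) (x N.+1))); rewrite /y add0n add1n.
  by split; rewrite ?lt_min ?ge_min ?lexx ?orbT ?x0 ?x1 //= andbT; lra.
have yc n : c <= y n /\ c <= y n.+1.
  elim: n => [//|n [h0 h1]]; split=> //; rewrite hy.
  have u1 := yub n.+1; set t := y n.+1 in h1 u1 *.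
  suff : c / 2 <= t * (3/4 - t * t) by lra.
  have [t2|t2] := leP t (1/2).
  - have : t * t <= 1/2 * (1/2) by apply: ler_pM; lra.
    move=> tt; apply: le_trans (_ : t * (1/2) <= _); first lra.
    by apply: ler_wpM2l; lra.
  - have : t * t <= 29/50 * (29/50) by apply: ler_pM; lra.
    move=> tt; apply: le_trans (_ : t * (2/5) <= _); first lra.
    by apply: ler_wpM2l; lra.
have ctr : tends_to (fun n => y n - 1/2) 0.
  apply: (@contraction_tends_to0 _ (1/2) ((1/2 - c) * (1 + c)) 0).
  - move=> n; have [? _] := yc n; have := yub n => ?.
    by rewrite ler_norml; lra.
  - by apply: mulr_ge0; lra.
  - have : 0 < c * (1/2 + c) by apply: mulr_gt0; lra.
    lra.
  - move=> n _; rewrite hy.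
    have [_ h1] := yc n; have := @near_half_contracts (y n) (y n.+1) (1/2 - c).
    have -> : 3/2 - (1/2 - c) = 1 + c by lra.
    by apply; rewrite ?yub //; lra.
by move=> e /ctr[M hM]; exists M => n /hM; rewrite subr0.
Qed.

(** The box is invariant: [g] is positive on it and has maximum [1/4], attained at
[1/2]. *)
Lemma positive_box_tends_to_half x N : henon_seq x ->
  0 < x N -> x N <= 1/2 -> 0 < x N.+1 -> x N.+1 <= 1/2 -> tends_to x (1/2).
Proof.
move=> hx x0 x0' x1 x1'; apply: (@positive_tends_to_half _ N) => // n Nn.
suff H m : x (m + N)%N <= 1/2 /\ (0 < x (m + N)%N) /\
   x (m + N).+1%N <= 1/2 /\ 0 < x (m + N).+1%N.
  by have := H (n - N)%N; rewrite subnK //; lra.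
elim: m => [//|m [h1 [h2 [h3 h4]]]]; rewrite addSn hx.
set t := x (m + N).+1 in h3 h4 *.
have h5 : 0 < t * (3/4 - t * t).
  apply: mulr_gt0 => //.
  have : t * t <= 1/2 * (1/2) by apply: ler_pM; lra.
  lra.
have h6 : 0 <= (t + 1) * ((t - 1/2) * (t - 1/2)).
  by apply: mulr_ge0; [lra | rewrite -expr2 sqr_ge0].
by split=> //; split=> //; split; lra.
Qed.

(** Used for the openness of the basins. *)
Lemma near_half_tends_to x N : henon_seq x ->
  `|x N - 1/2| <= 2/25 -> `|x N.+1 - 1/2| <= 2/25 -> tends_to x (1/2).
Proof.
move=> hx; rewrite !ler_norml => /andP[a0 b0] /andP[a1 b1].
apply: (@positive_tends_to_half _ N) => //; try lra; move=> n Nn.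
suff H m : (`|x (m + N)%N - 1/2| <= 2/25) /\ (`|x (m + N).+1%N - 1/2| <= 2/25).
  by have [+ _] := H (n - N)%N; rewrite subnK // ler_norml; lra.
elim: m => [|m [h1 h2]]; first by rewrite add0n !ler_norml; lra.
rewrite addSn; split => //; rewrite hx.
have v := h2; rewrite ler_norml in v.
apply: le_trans (@near_half_contracts _ _ (1/10) _ _ _ _) _; lra.
Qed.
End RealSequences.

(** * Limits of bounded real orbits *)

Section BoundedOrbits.
Variable R : realType.
Implicit Types (x u z : nat -> R) (c e t a M : R).

Lemma cubic_le_peak t : -1 <= t -> 3/4 * t - t ^+ 3 <= 1/4.
Proof.
move=> t1; have : 0 <= (t + 1) * ((t - 1/2) * (t - 1/2)).
  by apply: mulr_ge0; [lra | rewrite -expr2 sqr_ge0].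
lra.
Qed.

Lemma cubic_mono (s t : R) : 1/2 <= s -> s <= t -> s ^+ 3 - 3/4 * s <= t ^+ 3 - 3/4 * t.
Proof.
move=> s12 st.
have h1 : 1/2 * (1/2) <= s * s by apply: ler_pM; lra.
have h2 : 1/2 * (1/2) <= t * t by apply: ler_pM; lra.
have h3 : 1/2 * (1/2) <= s * t by apply: ler_pM; lra.
have : 0 <= (t - s) * (s * s + s * t + t * t - 3/4) by apply: mulr_ge0; lra.
lra.
Qed.

Lemma sqrt54_bounds a : 0 < a -> a * a = 5/4 -> 1118/1000 <= a <= 1119/1000.
Proof.
move=> a0 aa; apply/andP; split; rewrite leNgt; apply/negP => h.
- by have : a * a < 1118/1000 * (1118/1000) by [apply: ltr_pM; lra]; lra.
- by have : 1119/1000 * (1119/1000) < a * a by [apply: ltr_pM; lra]; lra.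
Qed.

(** Between [1/2] and [a] the cubic cannot reach the value [M / 2] needed to
return to height [M]: on [-M, M] it is at most [max (1/4) (M^3 - 3/4 M)], and
[M^3 - 3/4 M < M / 2] because [M^2 < 5/4]. *)
Lemma no_abs_limsup_between x M e n : henon_seq x ->
  1/2 < M -> M * M < 5/4 -> 0 < e -> 3 * e < M - 1/2 -> 6 * e < M * (5/4 - M * M) ->
  `|x n| <= M + e -> `|x n.+1| <= M + e -> x n.+2 <= M - e.
Proof.
move=> hx M12 M54 e0 e1 e2; rewrite !ler_norml hx => /andP[_ x0] /andP[x1 _].
set t := x n.+1 in x1 *.
have [t1|t1] := leP (-1) t; first by have := cubic_le_peak t1; lra.
have := @cubic_mono (- t) (M + e) ltac:(lra) ltac:(lra).
have -> : (M + e) ^+ 3 - 3/4 * (M + e)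
  = M ^+ 3 - 3/4 * M + e * (3 * (M * M) + 3 * M * e + e * e - 3/4) by ring.
have M2 : M <= 112/100.
  rewrite leNgt; apply/negP => h.
  by have : 112/100 * (112/100) < M * M by [apply: ltr_pM; lra]; lra.
have : e * (3 * (M * M) + 3 * M * e + e * e - 3/4) <= e * (9/2).
  apply: ler_wpM2l; first lra.
  have : M * e <= 112/100 * (1/4) by apply: ler_pM; lra.
  have : e * e <= 1/4 * (1/4) by apply: ler_pM; lra.
  lra.
lra.
Qed.

(** Above [a], reaching height near [M] forces the previous term below [- a];
then the next term is at most [- a / 2 - (y^3 - 3/4 y)] with [y] near [M],
and since the cubic has slope at least 3 beyond [a] this lies below [- M - e]. *)
Lemma no_abs_limsup_above x a M e n : henon_seq x -> 0 < a -> a * a = 5/4 ->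
  0 < e -> 3 * e <= M - a ->
  `|x n| <= M + e -> `|x n.+1| <= M + e -> `|x n.+3| <= M + e -> x n.+2 <= M - e.
Proof.
move=> hx a0 aa e0 eM; rewrite !ler_norml (hx n.+1).
move=> /andP[_ x0] /andP[x1 _] /andP[x3 _].
rewrite leNgt; apply/negP => x2; have x2E := hx n.
have /andP[a1 a2] := sqrt54_bounds a0 aa.
set t := x n.+1 in x1 x2E x3; set y := x n.+2 in x2 x2E x3.
have ta : t <= - a.
  rewrite leNgt; apply/negP => ta.
  have [t1|t1] := leP (-1) t; first by have := cubic_le_peak t1; lra.
  have s1 : 1 < - t by lra.
  have sa : - t < a by lra.
  have a_ge1 : 1 <= a by lra.
  have h1 := ler_pM ler01 ler01 (ltW s1) (ltW s1).
  have h3 := ler_pM ler01 ler01 (ltW s1) a_ge1.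
  have : 0 < (a + t) * ((-t) * (-t) + (-t) * a + a * a - 3/4) by apply: mulr_gt0; lra.
  have a3 : a ^+ 3 = 5/4 * a by rewrite -aa; ring.
  lra.
have ay : a <= y by lra.
have h1 := ler_pM (ltW a0) (ltW a0) ay ay.
have h2 := ler_pM (ltW a0) (ltW a0) ay (lexx a).
have : (y - a) * 3 <= (y - a) * (y * y + y * a + a * a - 3/4).
  by apply: ler_wpM2l; lra.
have a3 : a ^+ 3 = 5/4 * a by rewrite -aa; ring.
lra.
Qed.

Lemma abs_limsup_values x a M : henon_seq x -> 0 < a -> a * a = 5/4 -> 0 <= M ->
  (forall e, 0 < e -> exists N, forall n, (N <= n)%N -> `|x n| <= M + e) ->
  (forall e N, 0 < e -> exists2 n, (N <= n)%N & M - e < `|x n|) ->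
  M <= 1/2 \/ M = a.
Proof.
move=> hx a0 aa M0 ub lb.
have [M12|M12] := leP M (1/2); first by left.
right; apply/eqP; apply: contrapT => /negP Ma.
have hxN := henon_seqN hx.
(* applying the one-sided lemmas to [x] and to [- x] bounds [|x n.+2|] *)
have key e : 0 < e -> ~ (forall y n, henon_seq y -> `|y n| <= M + e ->
    `|y n.+1| <= M + e -> `|y n.+3| <= M + e -> y n.+2 <= M - e).
  move=> e0 H; have [N hN] := ub e e0; have [n nN hn] := lb e N.+2 e0.
  have [m mE] : exists m, n = m.+2 by exists n.-2; lia.
  rewrite mE in hn; have h0 : `|x m| <= M + e by apply: hN; lia.
  have h1 : `|x m.+1| <= M + e by apply: hN; lia.
  have h3 : `|x m.+3| <= M + e by apply: hN; lia.
  have hp : x m.+2 <= M - e by apply: H.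
  have hm : - x m.+2 <= M - e by apply: (H (fun n => - x n)); rewrite ?normrN.
  by move: hn; rewrite ltNge ler_norml; lra.
have [Ma'|Ma'|Ma'] := ltgtP M a; last by rewrite Ma' eqxx in Ma.
- have MM : M * M < 5/4 by rewrite -aa; apply: ltr_pM.
  have p0 : 0 < M * (5/4 - M * M) by apply: mulr_gt0; lra.
  (* 7 rather than 6 gives the strict inequalities of [no_abs_limsup_between] *)
  pose e := Num.min (M - 1/2) (M * (5/4 - M * M)) / 7.
  have e0 : 0 < e by rewrite /e divr_gt0 // lt_min; lra.
  have e1 : 7 * e <= M - 1/2.
    have : Num.min (M - 1/2) (M * (5/4 - M * M)) <= M - 1/2 by rewrite ge_min lexx.
    by rewrite /e; lra.
  have e2 : 7 * e <= M * (5/4 - M * M).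
    have : Num.min (M - 1/2) (M * (5/4 - M * M)) <= M * (5/4 - M * M).
      by rewrite ge_min lexx orbT.
    by rewrite /e; lra.
  apply: (key e e0) => y n hy y0 y1 _.
  by apply: no_abs_limsup_between => //; lra.
- have e0 : 0 < (M - a) / 3 by lra.
  apply: (key _ e0) => y n hy y0 y1 y3.
  by apply: (@no_abs_limsup_above _ a) => //; lra.
Qed.

(** At [- a] the cubic has slope [-3], so coming within [d] of [a] from a term at
most [a + d] needs a preceding term within [d / 2] of [- a]; the bound [d]
leaves room for the second order terms. *)
Lemma near_cycle_backward x a d n : henon_seq x -> 0 < a -> a * a = 5/4 ->
  0 < d -> d <= 1/10 -> `|x n| <= a + d -> a - d <= `|x n.+2| ->
  a - d <= `|x n.+1| /\ x n.+1 * x n.+2 < 0.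
Proof.
move=> hx a0 aa d0 d1.
have /andP[a1 a2] := sqrt54_bounds a0 aa.
suff H y : henon_seq y -> `|y n| <= a + d -> a - d <= y n.+2 ->
    y n.+1 <= - (a - d).
  move=> x0; have [x2|x2] := leP 0 (x n.+2) => h.
  - rewrite ger0_norm // in h; have h' := H x hx x0 h; split; first by rewrite ler0_norm; lra.
    by rewrite nmulr_rlt0; lra.
  - rewrite ltr0_norm // in h.
    have h' := H (fun n => - x n) (henon_seqN hx) ltac:(by rewrite normrN) h.
    split; first by rewrite ger0_norm; lra.
    by rewrite pmulr_rlt0; lra.
move=> hy; rewrite hy ler_norml => /andP[_ y0]; set t := y n.+1 => y2.
rewrite leNgt; apply/negP => ta.
have [t1|t1] := leP (-1) t; first by have := cubic_le_peak t1; lra.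
have := @cubic_mono (- t) (a - d) ltac:(lra) ltac:(lra).
have -> : (a - d) ^+ 3 - 3/4 * (a - d)
  = a * (a * a) - 3/4 * a - d * (3 * (a * a) - 3 * a * d + d * d - 3/4) by ring.
have : d * (26/10) <= d * (3 * (a * a) - 3 * a * d + d * d - 3/4).
  apply: ler_wpM2l; first lra.
  have := mulr_ge0 (ltW d0) (ltW d0).
  have := ler_pM (ltW a0) (ltW d0) a2 d1.
  lra.
rewrite aa; lra.
Qed.

Definition tends_to_cycle a x := forall d, 0 < d -> exists N, forall n, (N <= n)%N ->
  [/\ a - d <= `|x n|, `|x n| <= a + d & x n * x n.+1 < 0].

(** Terms close to [a] in absolute value occur arbitrarily late, and closeness
propagates backwards, so it holds for all large indices. *)
Lemma tends_to_cycle_of_limsup x a : henon_seq x -> 0 < a -> a * a = 5/4 ->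
  (forall e, 0 < e -> exists N, forall n, (N <= n)%N -> `|x n| <= a + e) ->
  (forall e N, 0 < e -> exists2 n, (N <= n)%N & a - e < `|x n|) ->
  tends_to_cycle a x.
Proof.
move=> hx a0 aa ub lb d' d'0.
pose d := Num.min d' (1/10).
have d0 : 0 < d by rewrite lt_min d'0; lra.
have dd' : d <= d' by rewrite ge_min lexx.
have d1 : d <= 1/10 by rewrite ge_min lexx orbT.
have [N hN] := ub d d0.
have low m n : (N < n)%N -> a - d <= `|x (n + m)%N| -> a - d <= `|x n|.
  elim: m => [|m IH] Nn; first by rewrite addn0.
  have [k kE] : exists k, (n + m)%N = k.+1 by exists (n + m).-1; lia.
  rewrite addnS kE in IH * => h; apply: IH => //.
  by have [] := near_cycle_backward hx a0 aa d0 d1 _ h; first by apply: hN; lia.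
have low' n : (N < n)%N -> a - d <= `|x n|.
  move=> Nn; have [k nk hk] := lb d n d0.
  by apply: (low (k - n)%N) => //; rewrite subnKC // ltW.
exists N.+1 => n Nn; split.
- by have := low' n Nn; lra.
- by have := hN n ltac:(lia); lra.
- have [k kE] : exists k, n = k.+1 by exists n.-1; lia.
  rewrite kE in Nn *.
  by apply: (near_cycle_backward hx a0 aa d0 d1 _ (low' _ _)).2; [apply: hN | ]; lia.
Qed.

(** If no two successive terms ever have the same sign, then [g (x n.+1)] opposes
[x n] in the recurrence, which leaves [|x n.+2| <= |x n| / 2]. *)
Lemma small_trichotomy x : henon_seq x ->
  (forall e, 0 < e -> exists N, forall n, (N <= n)%N -> `|x n| <= 1/2 + e) ->
  [\/ tends_to x (1/2), tends_to x (- (1/2)) | tends_to x 0].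
Proof.
move=> hx ub; have [N hN] := ub (2/25) ltac:(lra).
have xb n : (N <= n)%N -> - (29/50) <= x n <= 29/50.
  by move=> /hN; rewrite ler_norml; lra.
have [[n [Nn x0 x1]]|np] := pselect (exists n, [/\ (N <= n)%N, 0 < x n & 0 < x n.+1]).
  apply: Or31; apply: (@positive_tends_to_half _ _ n) => // k nk.
  by have /andP[] := xb k ltac:(lia).
have [[n [Nn x0 x1]]|nm] := pselect (exists n, [/\ (N <= n)%N, x n < 0 & x n.+1 < 0]).
  apply: Or32; apply: tends_toN; rewrite opprK.
  apply: (@positive_tends_to_half _ _ n (henon_seqN hx)); rewrite ?oppr_gt0 // => k nk.
  by have := xb k ltac:(lia); lra.
apply: Or33.
suff H : tends_to (fun n => x (n + N)%N) 0 by exact: tends_to_shift H.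
have half_gt0 : 0 < 1/2 :> R by lra.
apply: (@contraction_tends_to0 _ _ (29/50) 0 0%N) => //; last first.
- move=> n _; rewrite mul0r addr0 !addSn.
  set m := (n + N)%N; have Nm : (N <= m)%N by rewrite /m; lia.
  have b0 := xb m ltac:(lia); have b1 := xb m.+1 ltac:(lia).
  have n1 : 0 < x m -> 0 < x m.+1 -> False by move=> *; apply: np; exists m.
  have n2 : x m < 0 -> x m.+1 < 0 -> False by move=> *; apply: nm; exists m.
  have n3 : 0 < x m.+1 -> 0 < x m.+2 -> False.
    by move=> *; apply: np; exists m.+1; split=> //; exact: leqW.
  have n4 : x m.+1 < 0 -> x m.+2 < 0 -> False.
    by move=> *; apply: nm; exists m.+1; split=> //; exact: leqW.
  have E := hx m; move: b1 n1 n2 n3 n4 E.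
  set t := x m.+1 => b1 n1 n2 n3 n4 E.
  have tt : t * t <= 1/2.
    have : 0 <= (29/50 - t) * (29/50 + t) by apply: mulr_ge0; lra.
    lra.
  have [t0|t0|t0] := ltgtP t 0.
  - have x0 : 0 <= x m by rewrite leNgt; apply/negP => h; exact: n2.
    have x2 : 0 <= x m.+2 by rewrite leNgt; apply/negP => h; exact: n4.
    rewrite !ger0_norm // E.
    have : t * (3/4 - t * t) <= 0 by rewrite nmulr_rle0 //; lra.
    lra.
  - have x0 : x m <= 0 by rewrite leNgt; apply/negP => h; exact: n1.
    have x2 : x m.+2 <= 0 by rewrite leNgt; apply/negP => h; exact: n3.
    rewrite !ler0_norm // E.
    have : 0 <= t * (3/4 - t * t) by apply: mulr_ge0; lra.
    lra.
  - have -> : x m.+2 = x m / 2 by rewrite E t0; ring.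
    by rewrite normrM [`|2^-1|]ger0_norm // invr_ge0 ler0n.
- by move=> n; rewrite ler_norml; apply: xb; lia.
Qed.

Lemma bounded_orbit_limits x a B : henon_seq x -> 0 < a -> a * a = 5/4 ->
  (forall n, `|x n| <= B) ->
  [\/ tends_to x (1/2), tends_to x (- (1/2)), tends_to x 0 | tends_to_cycle a x].
Proof.
move=> hx a0 aa xB; have [M [M0 ub lb]] := exists_abs_limsup xB.
have [M12|Ma] := abs_limsup_values hx a0 aa M0 ub lb.
- have : forall e, 0 < e -> exists N, forall n, (N <= n)%N -> `|x n| <= 1/2 + e.
    by move=> e /ub[N hN]; exists N => n /hN; lra.
  by move=> /(small_trichotomy hx)[]; [apply: Or41|apply: Or42|apply: Or43].
- by rewrite {M0}Ma in ub lb; apply: Or44; exact: tends_to_cycle_of_limsup.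
Qed.
End BoundedOrbits.

(** * Real perturbations of orbits in the stable sets *)

Section PerturbedOrbits.
Variable R : realType.
Implicit Types (x y z : nat -> R) (a d s t : R).

Lemma exists_natmul_gt d t : 0 < d -> exists n, t < n%:R * d.
Proof.
move=> d0; exists (Num.bound (`|t| / d)).
rewrite -ltr_pdivrMr //; apply: le_lt_trans (archi_boundP _).
  by rewrite ler_wpM2r ?ler_norm // invr_ge0 ltW.
by rewrite divr_ge0 // ltW.
Qed.

(** As long as the difference [D] of the two orbits stays below [1/20], it obeys
[D n.+2 = D n / 2 + k D n.+1] with [k] between [7/10] and [3/4].  Hence
successive ratios stay between [7/10] and [3/2], and [D n + 2 D n.+1] grows
at least linearly, so [1/20] is eventually exceeded.  At that moment both
differences are larger than [1/40], and the perturbed orbit is in the positive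
box. *)
Lemma perturbed_stable_orbit_tends_to_half x y d : henon_seq x -> henon_seq y ->
  (forall n, `|x n| <= 1/40) -> 0 < d -> d <= 1/20 ->
  y 0%N = x 0%N + d -> y 1%N = x 1%N + d -> tends_to y (1/2).
Proof.
move=> hx hy xs d0 d1 y0 y1; pose D n := y n - x n.
apply: contrapT => ny.
have nogood n : 0 < y n -> y n <= 1/2 -> 0 < y n.+1 -> y n.+1 <= 1/2 -> False.
  by move=> *; apply: ny; apply: (@positive_box_tends_to_half _ _ n).
(* the growth rate [2/5] is [2 * (7/10) - 1], from [D n + 2 D n.+1] at the next step *)
have inv n : [/\ d <= D n, D n <= 1/20, d <= D n.+1, D n.+1 <= 1/20 &
    [/\ 7/10 * D n <= D n.+1, D n.+1 <= 3/2 * D n & n%:R * (2/5 * d) <= D n + 2 * D n.+1]].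
  elim: n => [|n [a0 b0 a1 b1 [r0 r1 S]]].
    by rewrite /D y0 y1 mul0r; split; rewrite ?[_ + d]addrC ?addrK //; try split; lra.
  have := xs n.+1; rewrite ler_norml => /andP[xl xr].
  have E : D n.+2 = D n / 2 + D n.+1 *
      (3/4 - (y n.+1 * y n.+1 + y n.+1 * x n.+1 + x n.+1 * x n.+1)).
    by rewrite /D hx hy; field.
  have yE : y n.+1 = x n.+1 + D n.+1 by rewrite /D; ring.
  rewrite yE in E; move: E xl xr; set p := x n.+1 => E xl xr.
  set q := D n.+1 in a1 b1 r0 r1 S E yE *.
  have hp : p * p <= 1/40 * (1/40).
    have : 0 <= (1/40 - p) * (1/40 + p) by apply: mulr_ge0; lra.
    lra.
  have pq1 : p * q <= 1/40 * (1/20).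
    by apply: le_trans (_ : 1/40 * q <= _); [apply: ler_wpM2r | apply: ler_wpM2l]; lra.
  have qq : q * q <= 1/20 * (1/20) by apply: ler_pM; lra.
  have k1 : q * (7/10) <= q * (3/4 - ((p + q) * (p + q) + (p + q) * p + p * p)).
    by apply: ler_wpM2l; lra.
  have k2 : q * (3/4 - ((p + q) * (p + q) + (p + q) * p + p * p)) <= q * (3/4).
    apply: ler_wpM2l; first lra.
    have := sqr_ge0 (p + q / 2); have := sqr_ge0 q; have := sqr_ge0 p; lra.
  have D2l : D n / 2 + q * (7/10) <= D n.+2 by rewrite E; lra.
  have D2r : D n.+2 <= D n / 2 + q * (3/4) by rewrite E; lra.
  (* exceeding [1/20] here would put the perturbed orbit into the positive box *)
  have D2s : D n.+2 <= 1/20.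
    rewrite leNgt; apply/negP => D2b.
    have y2E : y n.+2 = x n.+2 + D n.+2 by rewrite /D; ring.
    have := xs n.+2; rewrite ler_norml => /andP[xl2 xr2].
    by apply: (nogood n.+1); rewrite ?y2E ?yE -/p; lra.
  by split; [lra..|split; rewrite -?[in n.+1%:R]addn1 ?natrD; lra].
have [n hn] := @exists_natmul_gt (2/5 * d) (3/20) ltac:(lra).
by have [_ ? _ ? [_ _ ?]] := inv n; lra.
Qed.

(** The recurrence satisfied by [(-1)^n x n]: it turns the saddle cycle into a
fixed point, near which the recurrence is monotone. *)
Definition flipped_henon_seq z :=
  forall n, z n.+2 = z n / 2 + z n.+1 ^+ 3 - 3 / 4 * z n.+1.

(** The map [t -> t^3 - 3/4 t] has slope at least 2 beyond 1, so order is
preserved and the gap at least doubles as long as the lower sequence stays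
beyond 1. *)
Lemma flipped_separation z y k : flipped_henon_seq z -> flipped_henon_seq y ->
  y 0%N <= z 0%N -> y 1%N <= z 1%N -> (forall j, (j < k)%N -> 1 <= y j.+1) ->
  forall j, (j <= k)%N ->
    [/\ y j <= z j, y j.+1 <= z j.+1 & 2 ^+ j * (z 1%N - y 1%N) <= z j.+1 - y j.+1].
Proof.
move=> hz hy h0 h1 yk; elim=> [|j IH] jk; first by split=> //; rewrite expr0 mul1r.
have [a0 a1 e] := IH (ltnW jk); have y1 := yk j jk.
suff E : 2 * (z j.+1 - y j.+1) <= z j.+2 - y j.+2.
  by split=> //; [lra | rewrite exprS; lra].
rewrite hz hy; move: a1 y1 {e}; set p := z j.+1; set q := y j.+1 => a1 y1.
have q2 : 1 * 1 <= q * q by apply: ler_pM.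
have p2 : 1 * 1 <= p * q by apply: ler_pM => //; lra.
have p3 : 1 * 1 <= p * p by apply: ler_pM => //; lra.
have : (p - q) * 2 <= (p - q) * (p * p + p * q + q * q - 3/4).
  by apply: ler_wpM2l; lra.
lra.
Qed.

Section Family.
Variables (Z : R -> nat -> R).
Hypothesis Zalt : forall s, flipped_henon_seq (Z s).
Hypothesis Z0 : forall s, Z s 0%N = Z 0 0%N.
Hypothesis Z1 : forall s, Z s 1%N = Z 0 1%N - s.
Hypothesis Zcont : forall k, continuous (Z^~ k).
Hypothesis Znear : forall k, 1117/1000 <= Z 0 k <= 112/100.

(** The level 103/100 is one from which the next term is lower still, so the value
at the next time lies below the level for the parameter [s] and above it for
the parameter 0.  Monotonicity in the parameter then keeps all smaller
parameters above the level. *)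
Lemma exit_parameter k : exists s, [/\ 0 < s, Z s k.+1 = 103/100 &
  forall u, 0 <= u -> u <= s -> forall j, (j <= k.+1)%N -> 103/100 <= Z u j].
Proof.
elim: k => [|k [s [s0 sk hs]]].
  exists (Z 0 1%N - 103/100); have n0 := Znear 0; have n1 := Znear 1.
  split; [lra | by rewrite Z1; lra | move=> u u0 us [|[|//]] _].
    by rewrite Z0; lra.
  by rewrite Z1; lra.
have cmp u v : 0 <= u -> u <= v -> v <= s -> forall j, (j <= k.+1)%N ->
    Z v j <= Z u j /\ Z v j.+1 <= Z u j.+1.
  move=> u0 uv vs j jk.
  have [] // := @flipped_separation (Z u) (Z v) k.+1 _ _ _ _ _ j => //.
  - by rewrite Z0 [Z u _]Z0.
  - by rewrite Z1 [Z u _]Z1; lra.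
  - by move=> i ik; have := hs v ltac:(lra) vs i.+1 ik; lra.
have low : Z s k.+2 <= 103/100.
  rewrite (Zalt s k) sk.
  have [+ _] := cmp 0 s (lexx _) (ltW s0) (lexx _) k ltac:(lia).
  by have /andP[_ +] := Znear k; lra.
have high := Znear k.+2.
have [||r] := @IVT R (Z^~ k.+2) 0 s (103/100) (ltW s0).
- exact/continuous_subspaceT/Zcont.
- by rewrite ge_min le_max low orbT /=; apply/orP; left; lra.
rewrite in_itv /= => /andP[r0 rs] rE.
have r0' : 0 < r.
  by rewrite lt_neqAle r0 andbT; apply/eqP => r00; rewrite -r00 in rE; lra.
exists r; split=> // u u0 ur j; rewrite leq_eqVlt => /orP[/eqP ->|jk].
- by rewrite -rE; apply: (cmp u r u0 ur rs k.+1 (leqnn _)).2.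
- by apply: hs => //; lra.
Qed.

(** The gap to the unperturbed orbit doubles at each step and is at most [1/10] at
the exit. *)
Lemma exit_parameter_small k : exists s, [/\ 0 < s, 2 ^+ k * s <= 1/10, Z s k.+1 = 103/100 &
  forall j, (j <= k.+1)%N -> 103/100 <= Z s j <= 112/100].
Proof.
have [s [s0 sk hs]] := exit_parameter k; exists s.
have cmp j : (j <= k)%N -> [/\ Z s j <= Z 0 j, Z s j.+1 <= Z 0 j.+1 &
    2 ^+ j * s <= Z 0 j.+1 - Z s j.+1].
  move=> jk; have -> : 2 ^+ j * s = 2 ^+ j * (Z 0 1%N - Z s 1%N).
    by rewrite (Z1 s); congr (_ * _); lra.
  apply: (@flipped_separation _ _ k) => //.
  - by rewrite Z0.
  - by rewrite Z1; lra.
  - by move=> i ik; have := hs s (ltW s0) (lexx _) i.+1 ltac:(lia); lra.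
split=> //.
- have [_ _] := cmp k (leqnn k); rewrite sk.
  by have /andP[_] := Znear k.+1; lra.
- move=> j jk; rewrite hs ?(ltW s0) //=.
  case: j jk => [|j] jk; first by have [+ _ _] := cmp 0%N ltac:(lia); have := Znear 0; lra.
  by have [_ + _] := cmp j jk; have := Znear j.+1; lra.
Qed.
End Family.

Lemma cubic_anti (s t : R) : - (1/2) <= s -> s <= t -> t <= 1/2 ->
  t ^+ 3 - 3/4 * t <= s ^+ 3 - 3/4 * s.
Proof.
move=> s12 st t12.
have h1 : 0 <= (1/2 - s) * (1/2 + s) by apply: mulr_ge0; lra.
have h2 : 0 <= (1/2 - t) * (1/2 + t) by apply: mulr_ge0; lra.
have h3 := sqr_ge0 (s - t).
have : 0 <= (t - s) * (3/4 - (s * s + s * t + t * t)) by apply: mulr_ge0; lra.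
lra.
Qed.

(** The term before the exit is determined to within a hundredth by the recurrence
solved backwards, and the following terms by interval arithmetic.  The level
103/100 is chosen so that the two final intervals keep a good distance from 0. *)
Lemma exit_enters_box z k : flipped_henon_seq z ->
  103/100 <= z k <= 112/100 -> 103/100 <= z k.+1 <= 112/100 -> z k.+2 = 103/100 ->
  [/\ 0 < z (k + 8)%N, z (k + 8)%N <= 1/2, - (1/2) <= z (k + 9)%N & z (k + 9)%N < 0].
Proof.
move=> hz z0 z1 z2E; rewrite !addnS addn0.
have up (l r u : R) : l <= u <= r -> 1/2 <= l ->
    l ^+ 3 - 3/4 * l <= u ^+ 3 - 3/4 * u <= r ^+ 3 - 3/4 * r.
  by move=> /andP[lu ur] l2; rewrite !cubic_mono //; lra.
have dn (l r u : R) : l <= u <= r -> - (1/2) <= l -> r <= 1/2 ->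
    r ^+ 3 - 3/4 * r <= u ^+ 3 - 3/4 * u <= l ^+ 3 - 3/4 * l.
  by move=> /andP[lu ur] l2 r2; rewrite !cubic_anti //; lra.
(* each interval contains the true range, rounded outwards to thousandths *)
have z1' : 1086/1000 <= z k.+1 <= 1104/1000.
  have E := hz k; rewrite z2E in E.
  apply/andP; split; rewrite leNgt; apply/negP => h.
  - have := @cubic_mono _ (z k.+1) (1086/1000) ltac:(lra) ltac:(lra); lra.
  - have := @cubic_mono _ (1104/1000) (z k.+1) ltac:(lra) ltac:(lra); lra.
have z3 : 863/1000 <= z k.+3 <= 873/1000.
  by rewrite hz z2E; clear - z1'; lra.
have z4 : 510/1000 <= z k.+4 <= 526/1000.
  by have := up _ _ _ z3 ltac:(clear; lra); rewrite (hz k.+2) z2E; clear; lra.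
have z5 : 181/1000 <= z k.+4.+1 <= 188/1000.
  by have := up _ _ _ z4 ltac:(clear; lra); rewrite (hz k.+3); clear - z3; lra.
have z6 : 120/1000 <= z k.+4.+2 <= 134/1000.
  by have := dn _ _ _ z5 ltac:(clear; lra) ltac:(clear; lra); rewrite (hz k.+4); clear - z4; lra.
have z7 : - (8/1000) <= z k.+4.+3 <= 6/1000.
  by have := dn _ _ _ z6 ltac:(clear; lra) ltac:(clear; lra); rewrite (hz k.+4.+1); clear - z5; lra.
have z8 : 55/1000 <= z k.+4.+4 <= 73/1000.
  by have := dn _ _ _ z7 ltac:(clear; lra) ltac:(clear; lra); rewrite (hz k.+4.+2); clear - z6; lra.
have z9 : - (60/1000) <= z k.+4.+4.+1 <= - (30/1000).
  by have := dn _ _ _ z8 ltac:(clear; lra) ltac:(clear; lra); rewrite (hz k.+4.+3); clear - z7; lra.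
clear - z8 z9; by split; lra.
Qed.
End PerturbedOrbits.

(** * The map as a homeomorphism, and orbits as sequences *)

Section Homeomorphism.
Variables (T : topologicalType) (f g : T -> T) (A : set T).

Lemma iter_continuous : continuous f -> forall n, continuous (iter n f).
Proof.
move=> fc; elim=> [|n IH] q; first exact: cvg_id.
by apply: (@continuous_comp _ _ _ (iter n f) f); [exact: IH | exact: fc].
Qed.

Lemma closure_iter_preimage n q : continuous g -> cancel f g -> cancel g f ->
  (forall p, A (f p) -> A p) -> closure A (iter n f q) -> closure A q.
Proof.
move=> gc fK gK Af; elim: n q => // n IH q; rewrite iterSr => /IH cA B qB.
have [p [Ap Bp]] : A `&` (g @^-1` B) !=set0 by apply: cA; apply: gc; rewrite fK.
by exists (g p); split=> //; apply: Af; rewrite gK.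
Qed.

Lemma interior_iter_image n q : continuous g -> cancel f g -> cancel g f ->
  (forall p, A p -> A (f p)) -> interior A q -> interior A (iter n f q).
Proof.
move=> gc fK gK Af Aq; elim: n => //= n IH.
have h : nbhs (f (iter n f q)) (g @^-1` A) by apply: gc; rewrite fK.
by apply: filterS h => p Ap; rewrite -(gK p); exact: Af.
Qed.

Lemma interior_iter_preimage n q : continuous f ->
  (forall p, A (f p) -> A p) -> interior A (iter n f q) -> interior A q.
Proof.
move=> fc Af; elim: n q => // n IH q; rewrite iterSr => /IH h.
have h' : nbhs q (f @^-1` A) by exact: fc.
by apply: filterS h' => p; exact: Af.
Qed.
End Homeomorphism.

Section HenonHomeomorphism.
Variable K : numFieldType.

Definition henon_inv (q : K * K) : K * K :=
  (2 * (q.2 + q.1 ^+ 3 - 3 / 4 * q.1), q.1).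

Lemma henonK : cancel (@henon K) henon_inv.
Proof. by move=> [u v]; rewrite /henon /henon_inv /=; congr (_, _); field. Qed.

Lemma henon_invK : cancel henon_inv (@henon K).
Proof. by move=> [u v]; rewrite /henon /henon_inv /=; congr (_, _); field. Qed.

Lemma cube_continuous : continuous (fun t : K^o => t ^+ 3 : K^o).
Proof.
move=> t; apply: (@cvgM K K^o (nbhs t) _ id (id \* id) t (t * t)); first exact: cvg_id.
by apply: (@cvgM K K^o (nbhs t) _ id id t t); exact: cvg_id.
Qed.

Lemma continuous_pair (f g : K^o * K^o -> K^o) : continuous f -> continuous g ->
  continuous (fun q => (f q, g q)).
Proof. by move=> fc gc q; exact: (cvg_pair (fc q) (gc q)). Qed.

Lemma fst_continuous : continuous (fun q : K^o * K^o => q.1).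
Proof. by move=> q; exact: cvg_fst. Qed.

Lemma snd_continuous : continuous (fun q : K^o * K^o => q.2).
Proof. by move=> q; exact: cvg_snd. Qed.

Lemma cube_comp_continuous (f : K^o * K^o -> K^o) :
  continuous f -> continuous (fun q => f q ^+ 3).
Proof.
move=> fc q; apply: (@continuous_comp _ _ _ f (fun t : K^o => t ^+ 3 : K^o)).
  exact: fc.
exact: cube_continuous.
Qed.

Lemma henon_continuous : continuous (@henon K : K^o * K^o -> K^o * K^o).
Proof.
apply: continuous_pair; first exact: snd_continuous.
move=> q; apply: cvgD; first apply: cvgB.
- by apply: cvgMr_tmp; exact: fst_continuous.
- exact: cube_comp_continuous snd_continuous q.
- by apply: cvgMl_tmp; exact: snd_continuous.
Qed.

Lemma henon_inv_continuous : continuous (henon_inv : K^o * K^o -> K^o * K^o).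
Proof.
apply: continuous_pair; last exact: fst_continuous.
move=> q; apply: cvgMl_tmp; apply: cvgB; first apply: cvgD.
- exact: snd_continuous.
- exact: cube_comp_continuous fst_continuous q.
- by apply: cvgMl_tmp; exact: fst_continuous.
Qed.
End HenonHomeomorphism.

Section RealOrbits.
Variable R : realType.
Implicit Types (q : R * R) (x : nat -> R).

(** Orbits are handled through first coordinates only: the second coordinate of
an iterate is the first coordinate of the next one. *)
Definition coord q n := (forward_orbit q n).1.

Lemma forward_orbitE q n : forward_orbit q n = (coord q n, coord q n.+1).
Proof. by rewrite [LHS]surjective_pairing. Qed.

Lemma coord_henon_seq q : henon_seq (coord q).
Proof. by []. Qed.

Lemma coord_shift q N : coord (forward_orbit q N) = fun n => coord q (n + N)%N.
Proof. by apply/funext => n; rewrite /coord /forward_orbit iterD. Qed.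

Lemma coordN q n : coord (- q) n = - coord q n.
Proof.
elim/ltn_ind: n => -[|[|n]] IH //.
by rewrite !coord_henon_seq !IH //; ring.
Qed.

Lemma tends_toP x l : x n @[n --> \oo] --> l <-> tends_to x l.
Proof.
split=> [/cvgrPdist_le h e e0|h].
  have [N _ hN] := h e e0; exists N => n Nn; rewrite distrC; exact: hN.
apply/cvgrPdist_le => e e0; have [N hN] := h e e0.
by exists N => // n Nn; rewrite distrC; exact: hN.
Qed.

Lemma forward_orbit_cvgP q l :
  forward_orbit q n @[n --> \oo] --> (l, l) <-> tends_to (coord q) l.
Proof.
rewrite -tends_toP; split=> h.
  exact: (cvg_comp _ _ h (@cvg_fst _ _ (nbhs l) (nbhs l) _)).
have -> : (fun n => forward_orbit q n) = (fun n => (coord q n, coord q n.+1)).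
  by apply/funext => n; exact: forward_orbitE.
have h' : coord q n.+1 @[n --> \oo] --> l by rewrite (cvg_shiftS (coord q)).
exact: (cvg_pair h h').
Qed.
End RealOrbits.

(** * Basins and stable sets in the real plane *)

Section RealSets.
Variable R : realType.
Implicit Types (p q : R * R) (x : nat -> R) (a d e : R).

Definition cycle_height : R := Num.sqrt 5 / 2.

Lemma cycle_height_gt0 : 0 < cycle_height.
Proof. by rewrite /cycle_height divr_gt0 // sqrtr_gt0 ltr0n. Qed.

Lemma cycle_height_sqr : cycle_height * cycle_height = 5/4.
Proof.
have : Num.sqrt 5 ^+ 2 = 5 :> R by rewrite sqr_sqrtr // ler0n.
by rewrite /cycle_height => h; rewrite -[in RHS]h; field.
Qed.

Lemma euclidean_dist_coord p q d : euclidean_dist p q < d ->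
  `|p.1 - q.1| < d /\ `|p.2 - q.2| < d.
Proof.
move=> h; split; apply: le_lt_trans h; rewrite -sqrtr_sqr ler_wsqrtr //.
  by rewrite lerDl sqr_ge0.
by rewrite lerDr sqr_ge0.
Qed.

Lemma euclidean_dist_le p q :
  euclidean_dist p q <= `|p.1 - q.1| + `|p.2 - q.2|.
Proof.
set S := `|_| + `|_|; have S0 : 0 <= S by rewrite addr_ge0.
have -> : S = Num.sqrt (S ^+ 2) by rewrite sqrtr_sqr ger0_norm.
rewrite ler_wsqrtr // /S [leRHS]sqrrD !real_normK ?num_real // addrAC lerDl.
by rewrite mulrn_wge0 // mulr_ge0.
Qed.

Lemma dist_to_set_has_inf q (A : set (R * R)) : A !=set0 ->
  has_inf [set euclidean_dist q s | s in A].
Proof.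
move=> [s As]; split; first by exists (euclidean_dist q s); exists s.
by exists 0 => _ [t _ <-]; exact: sqrtr_ge0.
Qed.

Lemma dist_to_set_ge0 q (A : set (R * R)) : A !=set0 -> 0 <= dist_to_set q A.
Proof.
move=> A0; apply: lb_le_inf; first by have [] := dist_to_set_has_inf q A0.
by move=> _ [t _ <-]; exact: sqrtr_ge0.
Qed.

(** The product condition on successive terms records that the orbit visits the
two points of the cycle in turn. *)
Lemma Ws_cycleP q : Ws_cycle R q <-> tends_to_cycle cycle_height (coord q).
Proof.
pose P := [set saddle_p R; saddle_p' R].
have P0 : P !=set0 by exists (saddle_p R); left.
rewrite /Ws_cycle /= tends_toP -/P.
have a0 := cycle_height_gt0; have aa := cycle_height_sqr.
have /andP[a1 a2] := sqrt54_bounds a0 aa.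
split=> h.
- move=> d' d'0; pose d := Num.min d' (1/10).
  have d0 : 0 < d by rewrite lt_min d'0; lra.
  have dd' : d <= d' by rewrite ge_min lexx.
  have d1 : d <= 1/10 by rewrite ge_min lexx orbT.
  have [N hN] := h (d / 2) ltac:(lra); exists N => n /hN.
  rewrite subr0 ger0_norm ?dist_to_set_ge0 // => dn.
  have [_ [s Ps <-] hs] :=
    inf_adherent (divr_gt0 d0 (ltr0n R 2)) (dist_to_set_has_inf (forward_orbit q n) P0).
  have {}hs : euclidean_dist (forward_orbit q n) s < d.
    by move: hs; rewrite -/(dist_to_set _ _); lra.
  have [] := euclidean_dist_coord hs; rewrite forward_orbitE /= !ltr_norml.
  case: Ps => -> /=; rewrite -/cycle_height => /andP[u0 u1] /andP[v0 v1].
  + have xn : coord q n < 0 by lra.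
    rewrite ltr0_norm //; split; [lra | lra |].
    by rewrite nmulr_rlt0 //; lra.
  + have xn : 0 < coord q n by lra.
    rewrite gtr0_norm //; split; [lra | lra |].
    by rewrite pmulr_rlt0 //; lra.
- move=> e e0; have [N hN] := h (e / 2) ltac:(lra); exists N => n Nn.
  rewrite subr0 ger0_norm ?dist_to_set_ge0 //.
  have [l0 r0 s0] := hN n Nn; have [l1 r1 _] := hN n.+1 (leqW Nn).
  suff [s Ps [s1 s2]] : exists2 s, P s & `|coord q n - s.1| <= e / 2 /\
      `|coord q n.+1 - s.2| <= e / 2.
    apply: le_trans (_ : euclidean_dist (forward_orbit q n) s <= _).
      by apply: (ge_inf (dist_to_set_has_inf (forward_orbit q n) P0).2); exists s.
    apply: le_trans (euclidean_dist_le _ _) _; rewrite forward_orbitE /=; lra.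
  have [xn|xn|xn] := ltgtP (coord q n) 0; last by rewrite xn mul0r ltxx in s0.
  + exists (saddle_p R); first by left.
    rewrite /= -/cycle_height; rewrite nmulr_rlt0 // in s0.
    by move: l0 r0 l1 r1; rewrite ltr0_norm // gtr0_norm // => *; rewrite !ler_norml; lra.
  + exists (saddle_p' R); first by right.
    rewrite /= -/cycle_height; rewrite pmulr_rlt0 // in s0.
    by move: l0 r0 l1 r1; rewrite gtr0_norm // ltr0_norm // => *; rewrite !ler_norml; lra.
Qed.

Lemma Omega_plusP q : Omega_plus R q <-> tends_to (coord q) (1/2).
Proof. exact: forward_orbit_cvgP. Qed.

Lemma Omega_minusP q : Omega_minus R q <-> tends_to (coord q) (- (1/2)).
Proof. exact: forward_orbit_cvgP. Qed.

Lemma Ws_zeroP q : Ws_zero R q <-> tends_to (coord q) 0.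
Proof. exact: forward_orbit_cvgP. Qed.

Lemma tends_to_coordN q l : tends_to (coord (- q)) l <-> tends_to (coord q) (- l).
Proof.
have -> : coord (- q) = fun n => - coord q n by apply/funext => n; exact: coordN.
split=> h; last by apply: tends_toN; rewrite (_ : (fun n => _) = coord q) //;
  apply/funext => n; rewrite opprK.
by apply: tends_toN; rewrite opprK.
Qed.

Lemma Omega_minusN q : Omega_minus R q <-> Omega_plus R (- q).
Proof. by rewrite Omega_minusP Omega_plusP tends_to_coordN. Qed.

Lemma Ws_zeroN q : Ws_zero R (- q) <-> Ws_zero R q.
Proof. by rewrite !Ws_zeroP tends_to_coordN oppr0. Qed.

Lemma Ws_cycleN q : Ws_cycle R (- q) <-> Ws_cycle R q.
Proof.
suff H p : Ws_cycle R p -> Ws_cycle R (- p) by split=> /H; rewrite ?opprK.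
rewrite !Ws_cycleP => h d /h[N hN]; exists N => n /hN.
by rewrite !coordN normrN mulrNN.
Qed.

Lemma tends_to_unique x l m : tends_to x l -> tends_to x m -> l = m.
Proof.
by move=> /tends_toP h1 /tends_toP h2; exact: (cvg_unique _ h1 h2).
Qed.

Lemma tends_to_cycle_not_tends_to x l : `|l| <= 1/2 ->
  tends_to_cycle cycle_height x -> ~ tends_to x l.
Proof.
move=> l12 hc hl; have [N hN] := hc (1/10) ltac:(lra).
have [N' hN'] := hl (1/10) ltac:(lra).
have [h _ _] := hN (maxn N N') ltac:(lia); have h' := hN' (maxn N N') ltac:(lia).
have /andP[a1 a2] := sqrt54_bounds cycle_height_gt0 cycle_height_sqr.
have := ler_normD (x (maxn N N') - l) l; rewrite subrK; lra.
Qed.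

Lemma Ws_disjoint_Omega_plus q : Ws_zero R q \/ Ws_cycle R q -> ~ Omega_plus R q.
Proof.
rewrite Ws_zeroP Ws_cycleP Omega_plusP => -[h /(tends_to_unique h)|h]; first lra.
by apply: tends_to_cycle_not_tends_to => //; rewrite ger0_norm; lra.
Qed.

Lemma Omega_disjoint q : Omega_plus R q -> ~ Omega_minus R q.
Proof.
by rewrite Omega_plusP Omega_minusP => h /(tends_to_unique h); lra.
Qed.

Lemma real_henon_continuous : continuous (@henon R : R * R -> R * R).
Proof. exact: henon_continuous. Qed.

Lemma real_henon_inv_continuous : continuous (@henon_inv R : R * R -> R * R).
Proof. exact: henon_inv_continuous. Qed.

Lemma Omega_plus_iter q N : Omega_plus R (forward_orbit q N) <-> Omega_plus R q.
Proof.
rewrite !Omega_plusP coord_shift; split; first exact: tends_to_shift.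
by move=> h e /h[M hM]; exists M => n nM; apply: hM; lia.
Qed.

(** Some iterate is within [1/25] of the sink, the points around it within [2/25]
converge, and iterates are continuous. *)
Lemma Omega_plus_open q : Omega_plus R q -> interior (Omega_plus R) q.
Proof.
move=> hq; have /Omega_plusP := hq => h; have [N hN] := h (1/25) ltac:(lra).
apply: (@interior_iter_preimage _ _ _ N q real_henon_continuous).
  by move=> p /(Omega_plus_iter p 1).
have x0 := hN N (leqnn N); have x1 := hN N.+1 ltac:(lia).
apply/nbhs_ballP; exists (1/25) => /=; first lra.
move=> p [b0 b1]; apply/Omega_plusP; apply: (@near_half_tends_to _ _ 0 (coord_henon_seq p)).
- have := ler_normD (coord p 0%N - coord q N) (coord q N - 1/2).
  have : `|coord q N - coord p 0%N| < 1/25 := b0.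
  by rewrite distrC addrA subrK; lra.
- have := ler_normD (coord p 1%N - coord q N.+1) (coord q N.+1 - 1/2).
  have : `|coord q N.+1 - coord p 1%N| < 1/25 := b1.
  by rewrite distrC addrA subrK; lra.
Qed.

Lemma closure_Omega_plus_iter q N :
  closure (Omega_plus R) (forward_orbit q N) -> closure (Omega_plus R) q.
Proof.
apply: (@closure_iter_preimage _ _ (@henon_inv R)).
- exact: real_henon_inv_continuous.
- exact: henonK.
- exact: henon_invK.
- by move=> p /(Omega_plus_iter p 1).
Qed.

Lemma closure_of_ball (A : set (R * R)) q :
  (forall e, 0 < e -> exists p, [/\ A p, `|q.1 - p.1| < e & `|q.2 - p.2| < e]) ->
  closure A q.
Proof.
move=> h B /nbhs_ballP[e /= e0 eB]; have [p [Ap p1 p2]] := h e e0.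
by exists p; split=> //; apply: eB.
Qed.

Lemma Ws_zero_closure_Omega_plus q : Ws_zero R q -> closure (Omega_plus R) q.
Proof.
move=> /Ws_zeroP h; have [N hN] := h (1/40) ltac:(lra).
apply: (@closure_Omega_plus_iter q N); apply: closure_of_ball => e e0.
pose d := Num.min (e / 2) (1/20).
have d0 : 0 < d by rewrite lt_min; lra.
have d1 : d <= 1/20 by rewrite ge_min lexx orbT.
have de : d <= e / 2 by rewrite ge_min lexx.
pose p : R * R := (coord q N + d, coord q N.+1 + d).
exists p; split.
- apply/Omega_plusP.
  apply: (@perturbed_stable_orbit_tends_to_half _ (fun n => coord q (n + N)%N) _ d) => //.
  by move=> n; rewrite -[coord _ _]subr0; apply: hN; lia.
- by rewrite /p /= opprD addrA subrr add0r normrN gtr0_norm //; lra.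
- by rewrite forward_orbitE /p /= opprD addrA subrr add0r normrN gtr0_norm //; lra.
Qed.

Lemma coord_shear_continuous p k :
  continuous (fun s : R => coord (p.1, p.2 + s) k).
Proof.
move=> s; pose g (s : R) : R * R := (p.1, p.2 + s).
have gc : continuous g.
  move=> t; have h1 : cst p.1 @ t --> p.1 by exact: cvg_cst.
  have h2 : (p.2 + s) @[s --> t] --> p.2 + t.
    by apply: cvgD; [exact: cvg_cst | exact: cvg_id].
  exact: (cvg_pair h1 h2).
have ic := @iter_continuous _ _ real_henon_continuous k.
have c1 := @continuous_comp _ _ _ g (iter k (@henon R)) s (gc s) (ic (g s)).
exact: (@continuous_comp _ _ _ _ fst s c1 (@cvg_fst _ _ _ _ _)).
Qed.

(** After enough iterations the orbit is close to the cycle and positive at even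
times; then the second coordinate is perturbed by the small exit parameter of
[exit_parameter_small], with an exit time whose parity makes the two terms of
equal sign positive. *)
Lemma Ws_cycle_closure_Omega_plus q : Ws_cycle R q -> closure (Omega_plus R) q.
Proof.
move=> /Ws_cycleP h; have [N0 hN0] := h (1/1000) ltac:(lra).
(* the signs alternate, so [N0] or its successor will do *)
have [N NN0 xN] : exists2 N, (N0 <= N)%N & 0 < coord q N.
  have [x0|x0] := ltP 0 (coord q N0); first by exists N0.
  exists N0.+1 => //; have [_ _] := hN0 N0 (leqnn _).
  have x0' : coord q N0 < 0.
    have [+ _ _] := hN0 N0 (leqnn _).
    have := sqrt54_bounds cycle_height_gt0 cycle_height_sqr.
    by rewrite ler0_norm //; lra.
  by rewrite nmulr_rlt0.
apply: (@closure_Omega_plus_iter q N); apply: closure_of_ball => e e0.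
pose P s : R * R := (coord q N, coord q N.+1 + s).
pose Z s n := (-1) ^+ n * coord (P s) n.
have PN0 : coord (P 0) = fun n => coord q (n + N)%N.
  by rewrite -coord_shift forward_orbitE /P addr0.
have Zpos n : 0 < Z 0 n.
  rewrite /Z PN0; elim: n => [|n IH]; first by rewrite expr0 mul1r.
  have [_ _ s0] := hN0 (n + N)%N ltac:(lia); rewrite exprS addSn.
  have : 0 < ((-1) ^+ n * coord q (n + N)%N) * ((-1) ^+ n.+1 * coord q (n + N).+1).
    rewrite exprS mulN1r mulNr mulrN mulrACA -expr2 sqrr_sign mul1r; lra.
  by rewrite pmulr_rgt0 // exprS.
have Znear n : 1117/1000 <= Z 0 n <= 112/100.
  have : `|Z 0 n| = `|coord q (n + N)%N| by rewrite /Z PN0 normrM normr_sign mul1r.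
  rewrite gtr0_norm // => ->; have [] := hN0 (n + N)%N ltac:(lia).
  have := sqrt54_bounds cycle_height_gt0 cycle_height_sqr; lra.
have Zalt s : flipped_henon_seq (Z s).
  move=> n; rewrite /Z coord_henon_seq !(exprS (-1)).
  have s3 : ((-1) ^+ n) ^+ 3 = (-1) ^+ n :> R.
    by rewrite exprS expr2 -expr2 sqrr_sign mulr1.
  set c := (-1) ^+ n in s3 *; set u := coord _ n; set v := coord _ n.+1.
  have -> : (-1 * c * v) ^+ 3 = - (c ^+ 3 * v ^+ 3) by ring.
  by rewrite s3; ring.
have Z0 s : Z s 0%N = Z 0 0%N by [].
have Z1 s : Z s 1%N = Z 0 1%N - s by rewrite /Z /coord /P /=; ring.
have Zcont k : continuous (Z^~ k).
  by move=> s; apply: cvgMl_tmp; exact: (@coord_shear_continuous (coord q N, coord q N.+1)).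
(* the exit time [m.*2.+2] makes the final indices [m.*2 + 8] and [m.*2 + 9] even and odd *)
have [m hm] := @exists_natmul_gt _ e (1/10) e0.
have [s [s0 s1 sE sb]] := exit_parameter_small Zalt Z0 Z1 Zcont Znear m.*2.+1.
have se : s < e.
  have p2 : m%:R <= 2 ^+ m.*2.+1 :> R.
    rewrite -natrX ler_nat; apply: leq_trans (ltnW (ltn_expl m.*2.+1 (ltnSn 1))).
    by rewrite -addnn leqW // leq_addl.
  rewrite ltNge; apply/negP => es.
  have : m%:R * e <= 2 ^+ m.*2.+1 * s by apply: ler_pM => //; exact: ltW.
  lra.
have [] := exit_enters_box (Zalt s) (sb m.*2 (leqW (leqnSn _))) (sb m.*2.+1 (leqnSn _)) sE.
have -> : (m.*2 + 8)%N = (m + 4).*2 by rewrite doubleD.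
have -> : (m.*2 + 9)%N = (m + 4).*2.+1 by rewrite doubleD addnS.
rewrite /Z exprS -mul2n exprM sqrrN expr1n expr1n mul1r mulr1 !mulN1r lerN2 oppr_lt0 => b0 b1 b2 b3.
exists (P s); split.
- apply/Omega_plusP.
  exact: (positive_box_tends_to_half (coord_henon_seq _) b0 b1 b3 b2).
- by rewrite /P /= subrr normr0.
- by rewrite forward_orbitE /P /= opprD addrA subrr add0r normrN gtr0_norm.
Qed.
End RealSets.

(** * A Cauchy estimate for complex polynomials *)

Section Cauchy.
Variable C : numClosedFieldType.

Lemma closed_prim_root_exists n : (0 < n)%N -> exists w : C, n.-primitive_root w.
Proof.
move=> n0; pose p : {poly C} := 'X^n - 1.
have [r Dp] := closed_field_poly_normal p.
move: Dp; rewrite (monicP (monicXnsubC 1 n0)) scale1r => Dp.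
have rn1 : all n.-unity_root r by apply/allP=> z; rewrite -root_prod_XsubC -Dp.
have sz_r : (n <= size r)%N.
  by rewrite -ltnS -(size_prod_XsubC r id) -Dp size_Xn_sub_1.
have [|z] := hasP (has_prim_root n0 rn1 _ sz_r); last by exists z.
by rewrite -separable_prod_XsubC -Dp separable_Xn_sub_1 // pnatr_eq0 -lt0n.
Qed.

Lemma sum_prim_root_expr n (w : C) j : n.-primitive_root w -> (0 < n)%N ->
  \sum_(k < n) (w ^+ j) ^+ k = if (n %| j)%N then n%:R else 0.
Proof.
move=> wn n0; rewrite (prim_order_dvd wn); case: eqP => [->|/eqP wj].
  by under eq_bigr do rewrite expr1n; rewrite sumr_const card_ord.
have := subrX1 (w ^+ j) n; rewrite -exprM mulnC exprM (prim_expr_order wn) expr1n subrr.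
by move=> /esym/eqP; rewrite mulf_eq0 subr_eq0 (negPf wj) => /eqP.
Qed.

(** The average of [w ^ (- k) p (r w ^ k)] over the powers of a primitive root of
unity [w], of order larger than the degree, is exactly [p`_1 r]: the discrete
form of the Cauchy integral, which needs no integration. *)
Lemma cauchy_coef1 (p : {poly C}) (r B : C) : 0 <= r ->
  (forall t, `|t| <= r -> `|p.[t]| <= B) -> `|p`_1| * r <= B.
Proof.
move=> r0 pB; pose n := (size p).+2.
have [w wn] := @closed_prim_root_exists n isT.
have w1 : `|w| = 1.
  by apply/eqP; rewrite -(@pexpr_eq1 _ `|w| n) // -normrX (prim_expr_order wn) normr1.
have avg : \sum_(k < n) w ^+ (n.-1 * k) * p.[r * w ^+ k] = n%:R * (p`_1 * r).
  have expand (k : 'I_n) : w ^+ (n.-1 * k) * p.[r * w ^+ k]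
      = \sum_(j < n) p`_j * r ^+ j * (w ^+ (j + n.-1)) ^+ k.
    rewrite (@horner_coef_wide _ n); last by rewrite /n; lia.
    rewrite mulr_sumr; apply: eq_bigr => j _.
    by rewrite exprMn -!exprM mulnDl exprD [(k * j)%N]mulnC; ring.
  rewrite (eq_bigr _ (fun k _ => expand k)).
  rewrite exchange_big /=.
  under eq_bigr => j _ do rewrite -mulr_sumr (sum_prim_root_expr _ wn) //.
  rewrite (bigD1 (@Ordinal n 1 isT)) //= big1 ?addr0 => [|j j1].
    by rewrite add1n dvdnn expr1; ring.
  case: ifP => [|_]; last by rewrite mulr0.
  have jn := ltn_ord j; have {}j1 : (j : nat) != 1%N by [].
  move=> /dvdnP[c cE]; exfalso; rewrite /= in cE.
  by move: c cE j1 jn; rewrite /n /= => -[|[|c]]; nia.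
have n0 : 0 < n%:R :> C by rewrite ltr0n.
rewrite -(ler_pM2l n0).
have -> : n%:R * (`|p`_1| * r) = `|n%:R * (p`_1 * r)|.
  by rewrite !normrM normr_nat (ger0_norm r0).
rewrite -avg; apply: le_trans (ler_norm_sum _ _ _) _.
have -> : n%:R * B = \sum_(k < n) B by rewrite sumr_const card_ord mulr_natl.
apply: ler_sum => k _; rewrite normrM normrX w1 expr1n mul1r; apply: pB.
by rewrite normrM normrX w1 expr1n mulr1 ger0_norm.
Qed.
End Cauchy.

(** * The complex filled set *)

Section RealParameters.
Variable R : realType.
Implicit Types (x v m : nat -> R) (B c : R).

(** Beyond 2 the cubic term dominates: if [m n.+1 > 2] is at least [m n], the
next term is at least [2 m n.+1], and the same situation recurs. *)
Lemma modulus_escape m B n : (forall n, m n <= B) ->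
  (forall n, m n.+1 ^+ 3 - 3/4 * m n.+1 - m n / 2 <= m n.+2) ->
  m n <= m n.+1 -> m n.+1 <= 2.
Proof.
move=> mB hm h; rewrite leNgt; apply/negP => m2.
have grow k : [/\ m (k + n)%N <= m (k + n).+1, 2 < m (k + n).+1 & k%:R <= m (k + n).+1].
  elim: k => [|k [h1 h2 h3]]; first by split=> //; lra.
  have := hm (k + n)%N; rewrite addSn; move: h1 h2 h3; set t := m (k + n).+1 => h1 h2 h3.
  have : 2 * 2 <= t * t by apply: ler_pM; lra.
  move=> tt; have : t * (2 * 2) <= t * (t * t) by apply: ler_wpM2l; lra.
  rewrite -[k.+1]addn1 natrD => ? ?.
  have : 2 * t <= m (k + n).+2 by lra.
  by split; lra.
have [k] := @exists_natmul_gt _ 1 B ltr01.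
by have [_ _] := grow k; have := mB (k + n).+1; lra.
Qed.

(** The first term exceeding the bound would be above 2 and not smaller than its
predecessor.  The bound depends on the starting point only, which makes
bounded orbits uniformly bounded on bounded sets. *)
Lemma modulus_bound m B : (forall n, m n <= B) ->
  (forall n, m n.+1 ^+ 3 - 3/4 * m n.+1 - m n / 2 <= m n.+2) ->
  forall n, m n <= Num.max 2 (Num.max (m 0%N) (m 1%N)).
Proof.
move=> mB hm; set M := Num.max _ _.
have M2 : 2 <= M by rewrite le_max lexx.
have H n : m n <= M /\ m n.+1 <= M; last by move=> n; have [] := H n.
elim: n => [|n [h0 h1]]; first by rewrite /M !le_max !lexx !orbT.
split=> //; rewrite leNgt; apply/negP => h2.
have := @modulus_escape m B n.+1 mB hm; lra.
Qed.

(** The solution of the variational equation along [x] with initial vector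
[(1, 1)]. *)
Fixpoint tangent_pair x n : R * R :=
  if n is k.+1 then
    let w := tangent_pair x k in (w.2, w.1 / 2 + (3/4 - 3 * x k.+1 ^+ 2) * w.2)
  else (1, 1).

Definition tangent x n := (tangent_pair x n).1.

Lemma tangent_rec x n :
  tangent x n.+2 = tangent x n / 2 + (3/4 - 3 * x n.+1 ^+ 2) * tangent x n.+1.
Proof. by []. Qed.

(** Both coefficients of the variational equation are positive with sum above 1. *)
Lemma tangent_unbounded_near_zero x : (forall n, `|x n| <= 1/10) ->
  forall t, exists n, t < tangent x n.
Proof.
move=> xs t; pose v := tangent x.
have inv n : [/\ 1 <= v n, 1 <= v n.+1 & n%:R * (2/5) <= v n + 2 * v n.+1].
  elim: n => [|n [h0 h1 h2]]; first by rewrite /v /tangent /=; split; lra.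
  have E : v n.+2 = v n / 2 + (3/4 - 3 * x n.+1 ^+ 2) * v n.+1 by exact: tangent_rec.
  have x2 : x n.+1 ^+ 2 <= 1/100.
    have := xs n.+1; rewrite ler_norml => /andP[l r].
    have : 0 <= (1/10 - x n.+1) * (1/10 + x n.+1) by apply: mulr_ge0; lra.
    lra.
  have : (7/10) * v n.+1 <= (3/4 - 3 * x n.+1 ^+ 2) * v n.+1.
    by apply: ler_wpM2r; lra.
  by rewrite -[in n.+1%:R]addn1 natrD => ?; split; lra.
have [n hn] := @exists_natmul_gt _ (2/5) (3 * t) ltac:(lra).
have [_ _ h] := inv n.
have [vt|vt] := ltP t (v n); first by exists n.
by exists n.+1; rewrite -/(v _); lra.
Qed.

(** The derivative of the cubic exceeds [5/2] in absolute value there, so absolute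
values at least double. *)
Lemma tangent_unbounded_near_cycle x : (forall n, 105/100 <= `|x n|) ->
  forall t, exists n, t < `|tangent x n|.
Proof.
move=> xs t; pose v := tangent x.
have inv n : [/\ 1 <= `|v n.+1|, `|v n| <= `|v n.+1| & n%:R <= `|v n.+1|].
  elim: n => [|n [h0 h1 h2]].
    by rewrite /v /tangent /= normr1; split; lra.
  have E : v n.+2 = v n / 2 + (3/4 - 3 * x n.+1 ^+ 2) * v n.+1 by exact: tangent_rec.
  have x2 : 11/10 <= x n.+1 ^+ 2.
    rewrite -real_normK ?num_real // expr2.
    have := xs n.+1 => xn.
    have : 105/100 * (105/100) <= `|x n.+1| * `|x n.+1| by apply: ler_pM; lra.
    lra.
  have h3 : (5/2) * `|v n.+1| <= `|(3/4 - 3 * x n.+1 ^+ 2) * v n.+1|.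
    by rewrite normrM; apply: ler_wpM2r => //; rewrite ler0_norm; lra.
  have h4 : `|(3/4 - 3 * x n.+1 ^+ 2) * v n.+1| <= `|v n.+2| + `|v n| / 2.
    have -> : (3/4 - 3 * x n.+1 ^+ 2) * v n.+1 = v n.+2 - v n / 2 by rewrite E; ring.
    apply: le_trans (ler_normB _ _) _; rewrite [`|_ / 2|]normrM.
    by rewrite [`|2^-1|]ger0_norm // invr_ge0.
  by rewrite -[in n.+1%:R]addn1 natrD; split; lra.
have [n] := @exists_natmul_gt _ 1 t ltr01; rewrite mulr1 => hn.
by exists n.+1; have [_ _ h] := inv n; rewrite -/(v _); lra.
Qed.
End RealParameters.

(** The condition on [d] makes [d] a fixed point at which the derivative of
the cubic vanishes. *)
Lemma henon_centered (F : numFieldType) (u s d : F) : d * d = 1/4 ->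
  u / 2 - (s + d) ^+ 3 + 3 / 4 * (s + d) - d
    = 1 / 2 * (u - d) - s * (s * (3 * d + s)).
Proof.
move=> dd.
have -> : (s + d) ^+ 3 = s ^+ 3 + 3 * (s * s) * d + 3 * s * (d * d) + d * (d * d).
  by ring.
by rewrite dd; field.
Qed.

Section ComplexOrbits.
Variable R : realType.
Import Normc.
Local Notation C := (R[i])%C.
Implicit Types (z w : C) (q p : C2 R) (n : nat).

Lemma norm_normc z : `|z| = ((normc z)%:C)%C.
Proof. by case: z => a b; rewrite normc_def. Qed.

Lemma normc_ge0 z : 0 <= normc z.
Proof. by case: z => a b; exact: sqrtr_ge0. Qed.

Lemma normc_real (r : R) : normc (r%:C)%C = `|r|.
Proof. by rewrite /= expr0n addr0 sqrtr_sqr. Qed.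

Lemma lt_norm_normc z (r : R) : (`|z| < (r%:C)%C) = (normc z < r).
Proof. by rewrite norm_normc ltcR. Qed.

Lemma le_norm_normc z (r : R) : (`|z| <= (r%:C)%C) = (normc z <= r).
Proof. by rewrite norm_normc lecR. Qed.

Lemma half_complex : (1 / 2 : C) = ((1 / 2 : R)%:C)%C.
Proof. by rewrite rmorphM rmorph1 fmorphV rmorph_nat. Qed.

Lemma three_quarters_complex : (3 / 4 : C) = ((3 / 4 : R)%:C)%C.
Proof. by rewrite rmorphM fmorphV !rmorph_nat. Qed.

Definition modulus q n := normc (iter n (@henon C) q).1.

Lemma modulus_rec q n :
  modulus q n.+1 ^+ 3 - 3/4 * modulus q n.+1 - modulus q n / 2 <= modulus q n.+2.
Proof.
rewrite /modulus /=; set z := iter n _ q; set u := z.1; set v := z.2.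
set w := u / 2 - v ^+ 3 + 3 / 4 * v.
have := le_normcD (- w) (1 / 2 * u + 3 / 4 * v).
have := le_normcD (1 / 2 * u) (3 / 4 * v).
have -> : - w + (1 / 2 * u + 3 / 4 * v) = v * (v * v) by rewrite /w; field.
rewrite normcN half_complex three_quarters_complex !normcM !normc_real.
rewrite !ger0_norm; lra.
Qed.

Lemma norm_pair_le q (r : R) :
  (`|q| <= (r%:C)%C) = (normc q.1 <= r) && (normc q.2 <= r).
Proof.
rewrite prod_normE comparable_ge_max ?real_comparable ?normr_real //.
by rewrite !le_norm_normc.
Qed.

Lemma K_plusP q : K_plus R q <-> exists B, forall n, modulus q n <= B.
Proof.
split=> [[M [/complex_realP[k ->] H]]|[B hB]].
- exists (k + 1) => n.
  have kk : (k%:C < (k + 1)%:C)%C by rewrite ltcR; lra.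
  have := H _ kk (iter n (@henon C) q); rewrite /= norm_pair_le => h.
  by have /andP[] := h (ex_intro2 _ _ n I erefl).
- exists (B%:C)%C; split; first by apply/complex_realP; exists B.
  move=> M BM _ [n _ <-] /=; apply: le_trans (ltW BM).
  by rewrite norm_pair_le; apply/andP; split; [exact: hB n | exact: hB n.+1].
Qed.

Lemma K_plus_modulus q n : K_plus R q ->
  modulus q n <= Num.max 2 (Num.max (normc q.1) (normc q.2)).
Proof. by move=> /K_plusP[B hB]; exact: (modulus_bound hB (modulus_rec q)). Qed.

Lemma modulus_shift q N n : modulus (iter N (@henon C) q : C2 R) n = modulus q (n + N)%N.
Proof. by rewrite /modulus iterD. Qed.

Lemma K_plus_henon q : K_plus R (henon q) <-> K_plus R q.
Proof.
split=> /K_plusP[B hB]; apply/K_plusP.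
  exists (Num.max (modulus q 0%N) B) => -[|n]; rewrite le_max ?lexx //.
  by apply/orP; right; have := hB n; rewrite (modulus_shift q 1) addn1.
by exists B => n; rewrite (modulus_shift q 1); exact: hB.
Qed.

Lemma complex_henon_continuous : continuous (@henon C : C2 R -> C2 R).
Proof. exact: (@henon_continuous C). Qed.

Lemma complex_henon_inv_continuous : continuous (@henon_inv C : C2 R -> C2 R).
Proof. exact: (@henon_inv_continuous C). Qed.

(** Radii in the topology of the complex plane are positive complex numbers, that
is, positive reals. *)
Lemma nbhs_bidisk q (A : set (C2 R)) : nbhs q A <->
  exists2 r : R, 0 < r & forall p, normc (q.1 - p.1) < r -> normc (q.2 - p.2) < r -> A p.
Proof.
split=> [/nbhs_ballP[e /= e0 eA]|[r r0 rA]].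
- have /complex_realP[r rE] : e \is Num.real by exact: gtr0_real.
  rewrite rE ltcR in e0; exists r => // p p1 p2; apply: eA; split;
    by rewrite -ball_normE /ball_ /= rE lt_norm_normc.
- apply/nbhs_ballP; exists (r%:C)%C; first by rewrite /= ltcR.
  move=> p [p1 p2]; apply: rA; rewrite -lt_norm_normc.
    by move: p1; rewrite -ball_normE.
  by move: p2; rewrite -ball_normE.
Qed.

(** Near a limit point, the uniform bound [modulus_bound] passes to the limit at
each fixed time. *)
Lemma K_plus_closed q : closure (K_plus R) q -> K_plus R q.
Proof.
move=> cq; apply/K_plusP.
pose M := Num.max 2 (Num.max (normc q.1) (normc q.2)).
exists (M + 2) => n.
have ic := @iter_continuous _ _ complex_henon_continuous n.
pose U : set (C2 R) := [set p | normc (q.1 - p.1) < 1 /\ normc (q.2 - p.2) < 1].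
have Uq : nbhs q U by apply/nbhs_bidisk; exists 1.
pose V : set (C2 R) := [set p | normc ((iter n (@henon C) q).1 - p.1) < 1].
have Vq : nbhs (iter n (@henon C) q : C2 R) V by apply/nbhs_bidisk; exists 1.
have [p [Kp [[p1 p2] pV]]] := cq _ (filterI Uq (ic q _ Vq)).
have := K_plus_modulus n Kp.
have : normc p.1 <= M + 1.
  have := le_normcD (p.1 - q.1) q.1; rewrite subrK -[p.1 - q.1]opprB normcN.
  have : normc q.1 <= M by rewrite /M !le_max lexx orbT.
  by move: p1; rewrite /=; lra.
have : normc p.2 <= M + 1.
  have := le_normcD (p.2 - q.2) q.2; rewrite subrK -[p.2 - q.2]opprB normcN.
  have : normc q.2 <= M by rewrite /M !le_max lexx !orbT.
  by move: p2; rewrite /=; lra.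
have M2 : 2 <= M by rewrite le_max lexx.
move=> h1 h2 h3.
have h4 : modulus p n <= M + 1 by apply: le_trans h3 _; rewrite !ge_max h1 h2; lra.
have := le_normcD ((iter n (@henon C) q).1 - (iter n (@henon C) p).1) (iter n (@henon C) p).1.
rewrite subrK; move: h4 pV; rewrite /V /modulus /=; lra.
Qed.

Local Notation emb := (@real_to_C2 R).

Lemma iter_henon_real (q : R * R) n :
  iter n (@henon C) (emb q) = emb (forward_orbit q n).
Proof.
elim: n => // n IH; rewrite /forward_orbit !iterS IH -/(forward_orbit q n).
rewrite /henon /real_to_C2 /=; congr (_, _).
by rewrite rmorphD rmorphB rmorphXn !rmorphM !fmorphV !rmorph_nat.
Qed.

Lemma modulus_real (q : R * R) n : modulus (emb q) n = `|coord q n|.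
Proof. by rewrite /modulus iter_henon_real normc_real. Qed.

(** The sinks are the solutions of [c * c = 1/4].  In the centred
coordinate a step gives at most [1/8 + (1/4)^2 (3/2 + 1/4) < 1/4]. *)
Lemma trap_in_K_plus (c : R) q : c * c = 1/4 ->
  normc (q.1 - (c%:C)%C) <= 1/4 -> normc (q.2 - (c%:C)%C) <= 1/4 -> K_plus R q.
Proof.
move=> cc q1 q2; apply/K_plusP; exists (1/4 + `|c|) => n.
suff [h _] : normc ((iter n (@henon C) q).1 - (c%:C)%C) <= 1/4 /\
    normc ((iter n (@henon C) q).2 - (c%:C)%C) <= 1/4.
  have := le_normcD ((iter n (@henon C) q).1 - (c%:C)%C) (c%:C)%C.
  rewrite subrK normc_real /modulus => hn; apply: le_trans hn _; exact: lerD.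
elim: n => [//|n [h1 h2]]; rewrite iterS; split=> //=.
set u := (iter n _ q).1 in h1 *; set v := (iter n _ q).2 in h2 *.
set s := v - (c%:C)%C in h2 *.
have -> : u / 2 - v ^+ 3 + 3 / 4 * v - (c%:C)%C =
    1 / 2 * (u - (c%:C)%C) - s * (s * (((3 * c)%:C)%C + s)).
  have cC : (c%:C)%C * (c%:C)%C = 1/4 :> C.
    by rewrite -rmorphM cc rmorphM fmorphV rmorph_nat rmorph1.
  have c3E : ((3 * c)%:C)%C = 3 * (c%:C)%C :> C by rewrite rmorphM rmorph_nat.
  by rewrite c3E -(henon_centered _ _ cC) /s subrK.
have c32 : `|3 * c| <= 3/2.
  rewrite normrM ger0_norm //.
  have : `|c| * `|c| = 1/4 by rewrite -normrM cc ger0_norm //; lra.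
  move=> h; rewrite leNgt; apply/negP => hc.
  have : 1/2 * (1/2) < `|c| * `|c| by apply: ltr_pM; lra.
  lra.
apply: le_trans (le_normcD _ _) _; rewrite normcN half_complex !normcM normc_real.
have := le_normcD ((3 * c)%:C)%C s; rewrite normc_real.
rewrite [`|1 / 2|]ger0_norm; last lra.
have s0 := normc_ge0 s; set t := normc s in h2 s0 *; set y := normc (_ + s) => hy.
have y0 : 0 <= y by exact: normc_ge0.
have : t * y <= 1/4 * (7/4) by apply: ler_pM; lra.
move=> ty; have : t * (t * y) <= 1/4 * (1/4 * (7/4)) by apply: ler_pM => //; apply: mulr_ge0.
lra.
Qed.

Lemma interior_K_plus_of_tends_to (c : R) (q : R * R) : c * c = 1/4 ->
  tends_to (coord q) c -> interior (K_plus R) (emb q).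
Proof.
move=> cc h; have [N hN] := h (1/8) ltac:(lra).
apply: (@interior_iter_preimage _ _ _ N _ complex_henon_continuous).
  by move=> p /K_plus_henon.
rewrite iter_henon_real forward_orbitE; apply/nbhs_bidisk; exists (1/8); first lra.
have near (t : R) z : `|t - c| <= 1/8 -> normc ((t%:C)%C - z) < 1/8 ->
    normc (z - (c%:C)%C) <= 1/4.
  move=> tc zt; have := le_normcD (z - (t%:C)%C) ((t%:C)%C - (c%:C)%C).
  by rewrite addrA subrK -rmorphB normc_real -[z - (t%:C)%C]opprB normcN; lra.
move=> p p1 p2; apply: (trap_in_K_plus cc).
- by apply: near p1; apply: hN.
- by apply: near p2; apply: hN; lia.
Qed.
End ComplexOrbits.

(** * Boundaries *)

Section JuliaSet.
Variable R : realType.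
Import Normc.
Local Notation C := (R[i])%C.
Local Notation emb := (@real_to_C2 R).
Implicit Types (q : R * R) (n : nat) (x y z : C).

(** The iterates of the map along the complex line through [(x, y)] in the
direction [(1, 1)], as polynomials in the parameter of the line. *)
Definition line_orbit x y n : {poly C} * {poly C} :=
  iter n (fun p => (p.2, (1 / 2) *: p.1 - p.2 ^+ 3 + (3 / 4) *: p.2))
    (x%:P + 'X, y%:P + 'X).

Lemma horner_line_orbit x y n t :
  ((line_orbit x y n).1.[t], (line_orbit x y n).2.[t])
    = iter n (@henon C) (x + t, y + t).
Proof.
elim: n => [|n IH]; first by rewrite /= !hornerE.
rewrite iterS -IH /henon /=; congr (_, _).
by rewrite !hornerE /=; field.
Qed.

Lemma coef_cube1 (p : {poly C}) : (p ^+ 3)`_1 = 3 * p`_0 ^+ 2 * p`_1.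
Proof.
rewrite !exprS expr0 mulr1 !(coefM, big_ord_recr, big_ord0) /= !subnn subn0; ring.
Qed.

(** The linear coefficients are the derivatives of the iterates, hence satisfy the
variational equation. *)
Lemma line_orbit_coef q n (p := line_orbit (q.1%:C)%C (q.2%:C)%C n) :
  [/\ p.1`_0 = ((coord q n)%:C)%C, p.1`_1 = ((tangent (coord q) n)%:C)%C,
      p.2`_0 = ((coord q n.+1)%:C)%C & p.2`_1 = ((tangent (coord q) n.+1)%:C)%C].
Proof.
rewrite {}/p; elim: n => [|n [h0 h1 h2 h3]].
  by rewrite /line_orbit /= !coefE /= !addr0 !add0r; split.
rewrite /line_orbit iterS -/(line_orbit _ _ n) /=; split=> //.
- rewrite coord_henon_seq !coefD coefN !coefZ h0 h2.
  have -> : ((line_orbit (q.1%:C)%C (q.2%:C)%C n).2 ^+ 3)`_0 = ((coord q n.+1)%:C)%C ^+ 3.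
    by rewrite !exprS !expr0 !mulr1 !coef0M h2.
  rewrite half_complex three_quarters_complex.
  by rewrite -rmorphXn -!rmorphM -rmorphN -!rmorphD; congr ((_%:C)%C); field.
- rewrite tangent_rec !coefD coefN !coefZ coef_cube1 h1 h2 h3.
  rewrite half_complex three_quarters_complex.
  have -> : 3 = ((3 : R)%:C)%C :> C by rewrite rmorph_nat.
  by rewrite -rmorphXn -!rmorphM -rmorphN -!rmorphD; congr ((_%:C)%C); field.
Qed.

(** On a bidisk of radius [r] inside [K_plus] all iterates are bounded by the same
[B], so the Cauchy estimate would bound all derivatives by [B / (r / 2)]. *)
Lemma not_interior_K_plus q : (forall t, exists n, t < `|tangent (coord q) n|) ->
  ~ interior (K_plus R) (emb q).
Proof.
move=> tub /nbhs_bidisk[r r0 rK].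
pose B := 2 + (`|q.1| + `|q.2| + r).
have [n hn] := tub (B / (r / 2)).
have r2 : 0 <= (((r / 2)%:C)%C : C) by rewrite ler0c divr_ge0 // ltW.
have /(cauchy_coef1 r2) : forall t : C, `|t| <= ((r / 2)%:C)%C ->
    `|(line_orbit (q.1%:C)%C (q.2%:C)%C n).1.[t]| <= (B%:C)%C.
  move=> t; rewrite !le_norm_normc => tr.
  pose p : C2 R := ((q.1%:C)%C + t, (q.2%:C)%C + t).
  have tr' : normc t < r by apply: le_lt_trans tr _; lra.
  have Kp : K_plus R p.
    by apply: rK; rewrite /p /= opprD addrA subrr add0r normcN.
  have := K_plus_modulus n Kp.
  have -> : modulus p n = normc (line_orbit (q.1%:C)%C (q.2%:C)%C n).1.[t].
    by rewrite /modulus -horner_line_orbit.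
  move=> h; apply: le_trans h _; rewrite !ge_max.
  have := le_normcD (q.1%:C)%C t; have := le_normcD (q.2%:C)%C t.
  rewrite !normc_real /p /= => h1 h2.
  have n1 := normr_ge0 q.1; have n2 := normr_ge0 q.2.
  by apply/and3P; split; rewrite /B; lra.
have [_ -> _ _] := line_orbit_coef q n.
rewrite norm_normc normc_real -rmorphM lecR leNgt => /negP; apply.
by rewrite -ltr_pdivrMr // divr_gt0.
Qed.

(** Interior points of [K_plus] are mapped to interior points, so it suffices to
look at an iterate from which the whole orbit stays near the saddle. *)
Lemma Ws_not_interior q : Ws_zero R q \/ Ws_cycle R q -> ~ interior (K_plus R) (emb q).
Proof.
move=> Wq; suff [N hN] : exists N, forall t, exists n,
    t < `|tangent (coord (forward_orbit q N)) n|.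
  move=> iq; apply: (not_interior_K_plus hN); rewrite -iter_henon_real.
  apply: (@interior_iter_image _ _ (@henon_inv C)) => //.
  - exact: complex_henon_inv_continuous.
  - exact: henonK.
  - exact: henon_invK.
  - by move=> p /K_plus_henon.
case: Wq => [/Ws_zeroP h|/Ws_cycleP h].
- have [N hN] := h (1/10) ltac:(lra); exists N => t.
  have [|n hn] := @tangent_unbounded_near_zero _ (coord (forward_orbit q N)) _ t.
    by move=> n; rewrite coord_shift -[coord _ _]subr0; apply: hN; lia.
  by exists n; apply: lt_le_trans hn (ler_norm _).
- have [N hN] := h (1/100) ltac:(lra); exists N.
  apply: tangent_unbounded_near_cycle => n; rewrite coord_shift.
  have [+ _ _] := hN (n + N)%N ltac:(lia).
  by have := sqrt54_bounds (@cycle_height_gt0 R) (@cycle_height_sqr R); lra.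
Qed.

Lemma real_K_plus_cases q : K_plus R (emb q) ->
  [\/ Omega_plus R q, Omega_minus R q | Ws_zero R q \/ Ws_cycle R q].
Proof.
move=> /K_plusP[B hB].
have xB n : `|coord q n| <= B by rewrite -modulus_real.
have [h|h|h|h] := bounded_orbit_limits (@coord_henon_seq R q)
  (@cycle_height_gt0 R) (@cycle_height_sqr R) xB.
- by apply: Or31; apply/Omega_plusP.
- by apply: Or32; apply/Omega_minusP.
- by apply: Or33; left; apply/Ws_zeroP.
- by apply: Or33; right; apply/Ws_cycleP.
Qed.

Lemma eventually_bounded (x : nat -> R) N c : (forall n, (N <= n)%N -> `|x n| <= c) ->
  exists B, forall n, `|x n| <= B.
Proof.
move=> h; exists (\sum_(i < N) `|x i| + `|c|) => n.
have s0 : 0 <= \sum_(i < N) `|x i| by apply: sumr_ge0.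
have [Nn|nN] := leqP N n; first by apply: le_trans (h n Nn) _; have := ler_norm c; lra.
rewrite (bigD1 (Ordinal nN)) //= -addrA lerDl addr_ge0 //.
exact: sumr_ge0.
Qed.

Lemma K_plus_of_tends_to q l : tends_to (coord q) l -> K_plus R (emb q).
Proof.
move=> h; have [N hN] := h 1 ltr01.
have [|B hB] := @eventually_bounded (coord q) N (1 + `|l|).
  move=> n /hN hn; have := ler_normD (coord q n - l) l; rewrite subrK => h'.
  by apply: le_trans h' _; exact: lerD.
by apply/K_plusP; exists B => n; rewrite modulus_real.
Qed.

Lemma Ws_K_plus q : Ws_zero R q \/ Ws_cycle R q -> K_plus R (emb q).
Proof.
case=> [/Ws_zeroP|/Ws_cycleP h]; first exact: K_plus_of_tends_to.
have [N hN] := h 1 ltr01.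
have [|B hB] := @eventually_bounded (coord q) N (cycle_height R + 1).
  by move=> n /hN[].
by apply/K_plusP; exists B => n; rewrite modulus_real.
Qed.

Lemma closure_Omega_plus_K_plus q : closure (Omega_plus R) q -> K_plus R (emb q).
Proof.
move=> cq; apply: K_plus_closed => A /nbhs_bidisk[r r0 rA].
have [|p [Op [p1 p2]]] := cq (ball q r); first exact: nbhsx_ballx.
exists (emb p); split; first by apply: K_plus_of_tends_to; exact/Omega_plusP.
have dist a b : `|a - b| < r -> normc ((a%:C)%C - (b%:C)%C) < r.
  by rewrite -rmorphB normc_real.
by apply: rA; [exact: dist p1 | exact: dist p2].
Qed.

Lemma opp_plane_continuous : continuous (fun q : R * R => - q).
Proof. exact: opp_continuous. Qed.

(** A boundary point has a bounded orbit and is outside the open set [Omega_plus];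
it is not in [Omega_minus] either, which is open and disjoint from
[Omega_plus]. *)
Lemma boundary_Omega_plus : boundary (Omega_plus R) = Ws_zero R `|` Ws_cycle R.
Proof.
apply/seteqP; split=> q.
- move=> [cq nq]; have [h|h|//] := real_K_plus_cases (closure_Omega_plus_K_plus cq).
    by case: nq; exact: Omega_plus_open.
  have /Omega_minusN/Omega_plus_open h' := h.
  have [p [Op /Omega_minusN Om]] := cq _ (opp_plane_continuous h').
  by case: (Omega_disjoint Op).
- move=> Wq; split; last first.
    by move=> /interior_subset; exact: Ws_disjoint_Omega_plus.
  by case: Wq => [/Ws_zero_closure_Omega_plus|/Ws_cycle_closure_Omega_plus].
Qed.

Lemma boundary_preimage_opp (A B : set (R * R)) : (forall q, A q <-> B (- q)) ->
  forall q, boundary B (- q) -> boundary A q.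
Proof.
move=> AB q [cB iB]; split=> [U Uq|iA].
- have U' : nbhs (- q) (-%R @^-1` U) by apply: opp_plane_continuous; rewrite opprK.
  by have [p [Bp Up]] := cB _ U'; exists (- p); split=> //; apply/AB; rewrite opprK.
- apply: iB; have A' : nbhs (- q) (-%R @^-1` A).
    by apply: opp_plane_continuous; rewrite opprK.
  by apply: filterS A' => p /AB; rewrite opprK.
Qed.

Lemma boundary_Omega_minus : boundary (Omega_minus R) = Ws_zero R `|` Ws_cycle R.
Proof.
have WN q : (Ws_zero R `|` Ws_cycle R) (- q) <-> (Ws_zero R `|` Ws_cycle R) q.
  have Z := Ws_zeroN q; have C := Ws_cycleN q.
  by split=> -[h|h]; [left; apply/Z|right; apply/C|left; apply/Z|right; apply/C].
have PM q : Omega_plus R q <-> Omega_minus R (- q).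
  by rewrite Omega_minusN opprK.
apply/seteqP; split=> q h.
- apply/WN; rewrite -boundary_Omega_plus.
  by apply: (boundary_preimage_opp PM); rewrite opprK.
- apply: (boundary_preimage_opp (@Omega_minusN R)).
  by rewrite boundary_Omega_plus; apply/WN.
Qed.

Lemma J_plus_realE : J_plus_real R = Ws_zero R `|` Ws_cycle R.
Proof.
apply/seteqP; split=> q.
- move=> [/K_plus_closed/real_K_plus_cases[/Omega_plusP h|/Omega_minusP h|//] nq].
  + by case: nq; apply: interior_K_plus_of_tends_to h; lra.
  + by case: nq; apply: interior_K_plus_of_tends_to h; lra.
- move=> Wq; split; last exact: Ws_not_interior.
  by apply: subset_closure; exact: Ws_K_plus.
Qed.
End JuliaSet.

Theorem theorem5p1 (R : realType) :
  boundary (Omega_plus R) = boundary (Omega_minus R) /\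
  boundary (Omega_minus R) = Ws_zero R `|` Ws_cycle R /\
  Ws_zero R `|` Ws_cycle R = J_plus_real R.
Proof.
by rewrite boundary_Omega_plus boundary_Omega_minus J_plus_realE.
Qed.
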